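(* Suppose $(1+b_i+c_i)(1+b_j+c_j)>0$ for all $i,j=1,2,\dots,n$. Let $\mathbf{X}^*=(f_1^*(X),f_2^*(X),\dots,f_n^*(X))\in\mathcal{C}(X)$. Then $\mathbf{X}^*$ is a Pareto optimal allocation if and only if, for (Lebesgue-almost every) $t$, $$\sum_{i\in\mathcal{I}}(f_i^* )'(t)=1 \quad\text{for}\quad \mathcal{I}=\mathcal{I}(t)=\operatorname*{argmin}_{k=1,2,\dots,n}\ \frac{(1+b_k)\,g_k(S_X(t))+c_k\,S_X(t)}{|1+b_k+c_k|},$$ and $(f_i^* )'(t)=0$ for $i\notin\mathcal{I}(t)$.
   Context: Let $(\Omega,\mathcal{F},\mathbb{P})$ be a probability space and $\mathcal{P}$ the set of almost surely finite real random variables on it. For $Y\in\mathcal{P}$ let $S_Y(t)=\mathbb{P}(Y>t)$. A concave distortion is a non-decreasing concave function $g:[0,1]\to[0,1]$ with $g(0)=0$, $g(1)=1$; its distortion risk measure is $$H_g(Y)=\int_{-\infty}^0\big(g[S_Y(t)]-1\big)\,dt+\int_0^\infty g[S_Y(t)]\,dt,\qquad Y\in\mathcal{P}.$$ There are $n\ge 2$ agents; agent $i$ has an initial random loss $X_i\in\mathcal{P}$, a concave distortion $g_i$, and cost parameters $b_i\ge 0$, $c_i\in\mathbb{R}$. Put $X=\sum_{i=1}^n X_i$ and $V_i(Y)=(1+b_i)H_{g_i}(Y)+c_i\,\mathbb{E}Y$. It is assumed that $H_{g_i}(X_i)$ is finite for all $i$. The set of allocations is $$\mathcal{A}(X)=\Big\{\mathbf{Y}=(Y_1,\dots,Y_n):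 X=\sum_{i=1}^nY_i,\ V_i(Y_i)\text{ finite for all } i\Big\}.$$ An allocation $\mathbf{X}^*\in\mathcal{A}(X)$ is Pareto optimal if whenever $\mathbf{Y}\in\mathcal{A}(X)$ satisfies $V_i(Y_i)\le V_i(X_i^* )$ for all $i$, then $V_i(Y_i)=V_i(X_i^* )$ for all $i$. The set of comonotone allocations is $$\mathcal{C}(X)=\Big\{(f_1(X),\dots,f_n(X))\in\mathcal{A}(X): f_i:\mathbb{R}\to\mathbb{R}\text{ continuous, non-decreasing},\ \sum_{i=1}^nf_i(x)=x\text{ for all }x\in\mathbb{R}\Big\}.$$ Such $f_i$ are 1-Lipschitz, so $f_i'$ exists Lebesgue-almost everywhere. *)

(* Defs.v *)
From HB Require Import structures.
From mathcomp Require Import all_boot all_order all_algebra.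
From mathcomp Require Import all_classical all_reals all_analysis.

Set Implicit Arguments.
Unset Strict Implicit.
Unset Printing Implicit Defensive.

Import Order.TTheory GRing.Theory Num.Theory.
Import numFieldNormedType.Exports.

Local Open Scope classical_set_scope.
Local Open Scope ring_scope.

(* A distortion is a total function on R; only its values on [0, 1] matter. *)
Record concave_distortion (R : realType) (g : R -> R) : Prop := {
  distortion_range : forall x : R, x \in `[0, 1] -> g x \in `[0, 1];
  distortion_nondecreasing : {in `[0, 1] &, {homo g : x y / x <= y}};
  distortion_concave : @convex_function R R^o `[0, 1]%classic (\- g);
  distortion0 : g 0 = 0;
  distortion1 : g 1 = 1
}.

Section Risk.
Context d (T : measurableType d) (R : realType) (P : probability T R).

Definition survival (Y : {RV P >-> R}) (t : R) : R := fine (ccdf Y t).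

Local Open Scope ereal_scope.

(* The first integral is in [-oo, 0] and the second one in [0, +oo]. Since
   -oo + +oo = -oo in \bar R, the value is finite only if both integrals are. *)
Definition distortion_risk (g : R -> R) (Y : {RV P >-> R}) : \bar R :=
  \int[lebesgue_measure]_(t in `]-oo, 0%R[) (g (survival Y t) - 1)%:E +
  \int[lebesgue_measure]_(t in `[0%R, +oo[) (g (survival Y t))%:E.

(* As 0 * x = 0 in \bar R even for infinite x, no condition is put on the mean
   of Y when c = 0. Otherwise the value is finite only if Y is integrable, the
   expectation of a non-integrable Y being infinite in \bar R. *)
Definition total_cost (g : R -> R) (b c : R) (Y : {RV P >-> R}) : \bar R :=
  (1 + b)%:E * distortion_risk g Y + c%:E * 'E_P[Y].

Variable n : nat.
Implicit Types (V : 'I_n -> {RV P >-> R} -> \bar R) (X : {RV P >-> R})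
  (Y : 'I_n -> {RV P >-> R}).

Definition allocation V X Y : Prop :=
  {ae P, forall w, X w = (\sum_(i < n) Y i w)%R} /\
  forall i, V i (Y i) \is a fin_num.

Definition pareto_optimal V X Y : Prop :=
  allocation V X Y /\
  forall Z : 'I_n -> {RV P >-> R}, allocation V X Z ->
    (forall i, V i (Z i) <= V i (Y i)) -> forall i, V i (Z i) = V i (Y i).

Definition comonotone_allocation V X (f : 'I_n -> R -> R) Y : Prop :=
  [/\ allocation V X Y,
      forall i w, Y i w = f i (X w),
      forall i, continuous (f i),
      forall i, {homo f i : x y / (x <= y)%R} &
      forall x, (\sum_(i < n) f i x)%R = x].

End Risk.

Definition argmin (R : realType) (n : nat) (F : 'I_n -> R) : pred 'I_n :=
  [pred k | [forall j, F k <= F j]].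

(* Main.v *)
Require Import Defs.
From HB Require Import structures.
From mathcomp Require Import all_boot all_order all_algebra.
From mathcomp Require Import all_classical all_reals all_analysis.
From mathcomp Require Import measurable_realfun ring lra.

Set Implicit Arguments.
Unset Strict Implicit.
Unset Printing Implicit Defensive.

Import Order.TTheory GRing.Theory Num.Theory.
Import numFieldNormedType.Exports.

Local Open Scope classical_set_scope.
Local Open Scope ring_scope.

(** The expenses of agent [k] for a loss [Y] are [`|1 + b k + c k|] times the
    Choquet integral
      [choquet P h_k Y = \int (h_k (P (Y > t)) - h_k 1 * (t < 0)) dt]
    for the concave function [h_k = cost (g k) (b k) (c k)], which is the
    quotient minimised in the definition of [I t] (lemma [total_cost_choquet]).
    The sign condition says that the numbers [h_k 1] are all equal to the same
    [e = 1] or [e = - 1] (lemma [cost1_eq]). Hence cash payments between agents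
    do not change the sum of the Choquet integrals, and Pareto optimality
    becomes the minimality of that sum.

    For a comonotone allocation the sum is explicit. Non-decreasing functions
    [f_k] with sum [id] are absolutely continuous, and the substitution
    [y = f_k x] gives
      [choquet P h_k (f_k (X)) = e * f_k 0 + \int layer_k(t) * f_k'(t) dt],
    where [layer_k(t) = h_k (P (X > t)) - e * (t < 0)] is the price that agent
    [k] puts on the layer [t] of [X] (lemmas [nonexpansive_density] and
    [choquet_comonotone]). The derivatives are weights of sum 1 on the agents.
    So the sum over [k] is at least the Choquet integral of [X] for the lower
    envelope [h = min_k h_k], with equality exactly when almost every layer is
    carried by agents who put the lowest price on it.

    Sufficiency needs the same lower bound for every allocation, comonotone or
    not. The envelope [h] is concave, and a Choquet integral for a concave
    function is subadditive. For [h s = min s a] this follows from the formula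
    of Rockafellar and Uryasev, which makes the integral a minimum of
    expectations (lemma [choquet_min]). Non-negative combinations of these
    functions and linear ones give all the piecewise linear concave functions,
    hence the interpolations of [h] from below, and Fatou's lemma gives [h]
    (lemma [le_choquet_integrable]). The losses may fail to be integrable, but
    then some [c_k] is zero, [h] is non-decreasing, and it is enough to
    truncate the losses from below (lemma [le_choquet_monotone]).

    For necessity, suppose that agent [i] carries layers [t] in a non-negligible
    set [A] on which [h_j (P (X > t)) < h_i (P (X > t))]. Move these layers to
    agent [j], and let a cash payment restore the expenses of agent [i]. The new
    allocation is still comonotone, and agent [j] strictly gains, which
    contradicts Pareto optimality (lemma [pareto_negligible]). *)

(** * Integrable real functions *)

Section integrable_functions.
Context d (T : measurableType d) (R : realType) (m : {measure set T -> \bar R}).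
Implicit Types f g : T -> R.

Lemma integrableD_EFin f g : m.-integrable setT (EFin \o f) ->
  m.-integrable setT (EFin \o g) ->
  m.-integrable setT (EFin \o (fun x => f x + g x)).
Proof. by move=> mf mg; exact: (integrableD measurableT mf mg). Qed.

Lemma integrableB_EFin f g : m.-integrable setT (EFin \o f) ->
  m.-integrable setT (EFin \o g) ->
  m.-integrable setT (EFin \o (fun x => f x - g x)).
Proof. by move=> mf mg; exact: (integrableB measurableT mf mg). Qed.

Lemma integrableZl_EFin k f : m.-integrable setT (EFin \o f) ->
  m.-integrable setT (EFin \o (fun x => k * f x)).
Proof. by move=> mf; exact: (integrableZl measurableT k mf). Qed.

Lemma integrable_sum_EFin n (F : 'I_n -> T -> R) :
  (forall i, m.-integrable setT (EFin \o F i)) ->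
  m.-integrable setT (EFin \o (fun x => \sum_(i < n) F i x)).
Proof.
move=> mF.
apply: (eq_integrable measurableT (fun x => (\sum_(i < n) (EFin \o F i) x)%E)).
  by move=> x _ /=; rewrite sumEFin.
exact: integrable_sum.
Qed.

Lemma Rintegral_sum n (F : 'I_n -> T -> R) :
  (forall i, m.-integrable setT (EFin \o F i)) ->
  \int[m]_x (\sum_(i < n) F i x) = \sum_(i < n) \int[m]_x F i x.
Proof.
elim: n F => [|n IH] F mF.
  rewrite big_ord0; under eq_Rintegral do rewrite big_ord0.
  by rewrite Rintegral_cst// mul0r.
rewrite big_ord_recr /=; under eq_Rintegral do rewrite big_ord_recr /=.
have mF' i := mF (widen_ord (leqnSn n) i).
rewrite RintegralD//; last exact: integrable_sum_EFin mF'.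
by rewrite IH.
Qed.

Lemma le_integrable_EFin f g : measurable_fun setT f ->
  (forall x, `|f x| <= g x) -> m.-integrable setT (EFin \o g) ->
  m.-integrable setT (EFin \o f).
Proof.
move=> mf fg; apply: le_integrable => //; first exact/measurable_EFinP.
move=> x _ /=; rewrite lee_fin (le_trans (fg x))//.
by rewrite ger0_norm// (le_trans _ (fg x)).
Qed.

Lemma ae_eq_Rintegral f f' :
  m.-integrable setT (EFin \o f) -> measurable_fun setT f' ->
  {ae m, forall x, f x = f' x} ->
  m.-integrable setT (EFin \o f') /\ \int[m]_x f x = \int[m]_x f' x.
Proof.
move=> /integrableP[mf fin] mf' ff'; split.
  apply/integrableP; split; first exact/measurable_EFinP.
  rewrite -(@ae_eq_integral _ _ _ _ _ _ (fun x => `|(f x)%:E|%E))//.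
  - exact: measurableT_comp.
  - by apply: measurableT_comp => //; exact/measurable_EFinP.
  - by apply: filterS ff' => x ->.
congr fine; apply: ae_eq_integral => //; first exact/measurable_EFinP.
by apply: filterS ff' => x ->.
Qed.

End integrable_functions.

(** * Survival functions *)

(** The survival function, for functions that are not packed as random
    variables, so that maxima and sums can be used directly. *)
Definition tail d (T : measurableType d) (R : realType) (P : probability T R)
  (Y : T -> R) (t : R) : R := fine (P [set w | t < Y w]).

Section tail.
Context d (T : measurableType d) (R : realType) (P : probability T R).
Implicit Types Y Z : T -> R.

Lemma survivalE (Y : {RV P >-> R}) : survival Y = tail P Y.
Proof.
apply/funext => t; rewrite /survival /ccdf /distribution /pushforward /tail.
by congr (fine (P _)); apply/seteqP; split => w /=; rewrite in_itv/= andbT.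
Qed.

Lemma measurable_gt Y t : measurable_fun setT Y -> measurable [set w | t < Y w].
Proof.
move=> mY; rewrite [X in measurable X](_ : _ = Y @^-1` `]t, +oo[).
  by rewrite -[X in measurable X]setTI; exact: mY.
by apply/seteqP; split => w /=; rewrite in_itv/= andbT.
Qed.

Lemma tail_ge0 Y t : 0 <= tail P Y t.
Proof. exact: fine_ge0. Qed.

Lemma tail_le1 Y t : measurable_fun setT Y -> tail P Y t <= 1.
Proof.
move=> mY; rewrite -lee_fin fineK ?fin_num_measure//; last exact: measurable_gt.
by apply: probability_le1; exact: measurable_gt.
Qed.

Lemma ae_le_tail Y Z t : measurable_fun setT Y -> measurable_fun setT Z ->
  {ae P, forall w, Y w <= Z w} -> tail P Y t <= tail P Z t.
Proof.
move=> mY mZ YZ; rewrite /tail fine_le ?fin_num_measure//;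
  [exact: measurable_gt..|].
have [N [mN N0 subN]] := YZ.
rewrite -[leRHS]adde0 -N0 (le_trans _ (measureU2 _ _ _))//; last first.
  exact: measurable_gt.
apply: le_measure; rewrite ?inE; [exact: measurable_gt| |].
  by apply: measurableU => //; exact: measurable_gt.
move=> w /= tY; have [YZw|YZw] := boolP (Y w <= Z w).
  by left; exact: lt_le_trans YZw.
by right; apply: subN => /=; exact/negP.
Qed.

Lemma ae_eq_tail Y Z : measurable_fun setT Y -> measurable_fun setT Z ->
  {ae P, forall w, Y w = Z w} -> tail P Y = tail P Z.
Proof.
move=> mY mZ YZ; apply/funext => t; apply/eqP; rewrite eq_le.
by rewrite !ae_le_tail//; apply: filterS YZ => w ->.
Qed.

Lemma tail_nonincreasing Y : measurable_fun setT Y ->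
  {homo tail P Y : s t / s <= t >-> t <= s}.
Proof.
move=> mY s t st; rewrite /tail fine_le ?fin_num_measure//;
  [exact: measurable_gt..|].
apply: le_measure; rewrite ?inE; [exact: measurable_gt..|].
by move=> w /=; exact: le_lt_trans.
Qed.

Lemma measurable_tail Y : measurable_fun setT Y -> measurable_fun setT (tail P Y).
Proof. by move=> mY; apply: nonincreasing_measurable => //; exact: tail_nonincreasing. Qed.

Lemma tail_max_lt Y z t : t < z -> tail P (fun w => Num.max (Y w) z) t = 1.
Proof.
move=> tz; rewrite /tail (_ : [set _ | _] = setT) ?probability_setT//.
by apply/seteqP; split => w //= _; rewrite lt_max tz orbT.
Qed.

Lemma tail_max_ge Y z t : z <= t ->
  tail P (fun w => Num.max (Y w) z) t = tail P Y t.
Proof.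
move=> zt; rewrite /tail; congr (fine (P _)).
by apply/seteqP; split => w /=; rewrite lt_max (ltNge t z) zt orbF.
Qed.

Lemma ccdf_tail Y (mY : measurable_fun setT Y) t :
  ccdf (mfun_Sub (mem_set mY) : {RV P >-> R}) t = (tail P Y t)%:E.
Proof.
rewrite -[tail P Y]/(tail P (mfun_Sub (mem_set mY))) -survivalE /survival.
by rewrite fineK// fin_num_measure.
Qed.

(** The threshold is a quantile of level [1 - a]; the inequality at the
    threshold itself comes from the right continuity of the tail. *)
Lemma tail_quantile Y a : measurable_fun setT Y -> 0 < a < 1 ->
  exists k, (forall t, t < k -> a <= tail P Y t) /\
            (forall t, k <= t -> tail P Y t <= a).
Proof.
move=> mY /andP[a0 a1]; pose Y' : {RV P >-> R} := mfun_Sub (mem_set mY).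
have tE t : ccdf Y' t = (tail P Y t)%:E by exact: ccdf_tail.
have [u ua] : exists u, tail P Y u <= a.
  have /fine_cvgP[_] := cvg_ccdfy0 Y'.
  move=> /(@cvgr_le _ _ _ _ _ 0) /(_ _ a0) [M [_ Ma]].
  by exists (M + 1); have := Ma (M + 1); rewrite /= tE /=; apply; rewrite ltrDl.
have [v va] : exists v, a < tail P Y v.
  have /fine_cvgP[_] := cvg_ccdfNy1 Y'.
  move=> /(@cvgr_gt _ _ _ _ _ 1) /(_ _ a1) [M [_ Ma]].
  by exists (M - 1); have := Ma (M - 1); rewrite /= tE /=; apply; rewrite ltrBlDr ltrDl.
pose E := [set t | tail P Y t <= a].
have lbE : lbound E v.
  move=> t /= ta; rewrite leNgt; apply/negP => tv.
  have := tail_nonincreasing mY (ltW tv).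
  by rewrite leNgt (le_lt_trans ta va).
have hE : has_inf E by split; [exists u|exists v].
exists (inf E); split => [t tk|t kt].
  rewrite leNgt; apply/negP => /ltW ta.
  by have := inf_lbound hE.2 ta; rewrite leNgt tk.
apply: (le_trans (tail_nonincreasing mY kt)).
rewrite leNgt; apply/negP => atail.
have /fine_cvgP[_] : ccdf Y' x @[x --> (inf E)^'+] --> (tail P Y (inf E))%:E.
  by rewrite -tE; exact: ccdf_right_continuous.
move=> /cvgr_gt /(_ _ atail) near_gt.
have near_gt' : \forall x \near (inf E)^'+, a < fine (ccdf Y' x) /\ inf E < x.
  by apply: filterI near_gt _; exact: nbhs_right_gt.
have [x [ax Ex]] := @filter_ex _ _ (at_right_proper_filter _) _ near_gt'.
have [e /= ae ex] := inf_lt hE.1 Ex.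
have := tail_nonincreasing mY (ltW ex).
by rewrite leNgt (le_lt_trans ae)//; move: ax; rewrite tE.
Qed.

End tail.

(** * Choquet integrals and their layers *)

(** The integrand of the Choquet integral of [Y] for the distortion [h], with
    the reference level [z] in place of 0. Moving the level turns statements
    about [f (X)] into statements about [X], see [layer_shift]. *)
Definition layer d (T : measurableType d) (R : realType) (P : probability T R)
  (h : R -> R) (Y : T -> R) (z t : R) : R :=
  h (tail P Y t) - h 1 * (t < z)%R%:R.

Definition choquet d (T : measurableType d) (R : realType) (P : probability T R)
  (h : R -> R) (Y : T -> R) : R :=
  \int[@lebesgue_measure R]_t layer P h Y 0 t.

Section layer.
Context d (T : measurableType d) (R : realType) (P : probability T R).
Notation mu := (@lebesgue_measure R).
Implicit Types (Y Z : T -> R) (h : R -> R).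

(** The signed indicator of the interval between 0 and [z], by which the layers
    at levels 0 and [z] differ, up to the factor [h 1]. *)
Let box (z t : R) : R := (t < z)%R%:R - (t < 0)%R%:R.

Let integrable_box z : mu.-integrable setT (EFin \o box z).
Proof.
have [z0|z0] := leP 0 z.
  rewrite (_ : box z = \1_`[0, z[); first exact: integrable_indic_itv.
  apply/funext => t; rewrite /box indicE mem_setE in_itv/=.
  by case: (ltP t 0) => t0; rewrite ?(lt_le_trans t0 z0) ?subrr ?subr0.
rewrite (_ : box z = fun t => -1 * \1_`[z, 0[ t).
  exact/integrableZl_EFin/integrable_indic_itv.
apply/funext => t; rewrite /box indicE mem_setE in_itv/=.
case: (ltP t z) => tz; last by rewrite sub0r mulN1r.
by rewrite (lt_trans tz z0) subrr mulr0.
Qed.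

Let Rintegral_box z : \int[mu]_t box z t = z.
Proof.
have [z0|z0] := leP 0 z.
  rewrite (_ : box z = \1_`[0, z[).
    rewrite /Rintegral integral_indic// setIT.
    rewrite [X in fine X](_ : _ = mu `[0, z[)// lebesgue_measure_itv/= lte_fin.
    by move: z0; rewrite le_eqVlt => /predU1P[<-|->]; rewrite ?ltxx//= subr0.
  apply/funext => t; rewrite /box indicE mem_setE in_itv/=.
  by case: (ltP t 0) => t0; rewrite ?(lt_le_trans t0 z0) ?subrr ?subr0.
rewrite (_ : box z = fun t => -1 * \1_`[z, 0[ t).
  rewrite RintegralZl//; last exact: integrable_indic_itv.
  rewrite /Rintegral integral_indic// setIT.
  rewrite [X in fine X](_ : _ = mu `[z, 0[)// lebesgue_measure_itv/= lte_fin z0/=.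
  by rewrite sub0r mulN1r opprK.
apply/funext => t; rewrite /box indicE mem_setE in_itv/=.
case: (ltP t z) => tz; last by rewrite sub0r mulN1r.
by rewrite (lt_trans tz z0) subrr mulr0.
Qed.

(** The reference level can be chosen freely, at the price [h 1] per unit. *)
Lemma layer_shift h Y z : mu.-integrable setT (EFin \o layer P h Y z) ->
  mu.-integrable setT (EFin \o layer P h Y 0) /\
  choquet P h Y = h 1 * z + \int[mu]_t layer P h Y z t.
Proof.
move=> iz.
have E : layer P h Y 0 = fun t => h 1 * box z t + layer P h Y z t.
  by apply/funext => t; rewrite /layer /box; ring.
have ib := integrableZl_EFin (h 1) (integrable_box z).
split; first by rewrite E; exact: integrableD_EFin.
by rewrite /choquet E RintegralD// RintegralZl// Rintegral_box.
Qed.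

Lemma layer_unshift h Y z : mu.-integrable setT (EFin \o layer P h Y 0) ->
  mu.-integrable setT (EFin \o layer P h Y z).
Proof.
move=> i0.
have E : layer P h Y z = fun t => layer P h Y 0 t - h 1 * box z t.
  by apply/funext => t; rewrite /layer /box; ring.
rewrite E; apply: integrableB_EFin => //.
exact: integrableZl_EFin (integrable_box z).
Qed.

Lemma measurable_layer h Y z : measurable_fun setT (h \o tail P Y) ->
  measurable_fun setT (layer P h Y z).
Proof.
move=> mh; apply: measurable_funB => //; apply: measurable_funM => //.
rewrite (_ : (fun t => _) = \1_`]-oo, z[); first exact: measurable_indic.
by apply/funext => t; rewrite indicE mem_setE in_itv.
Qed.

(** Distortion risk measures are defined by separate integrals over the two
    half-lines. *)
Lemma integral_split0 (L : R -> R) : mu.-integrable setT (EFin \o L) ->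
  (\int[mu]_(t in `]-oo, 0%R[) (L t)%:E + \int[mu]_(t in `[0%R, +oo[) (L t)%:E)%E
  = (\int[mu]_t L t)%:E.
Proof.
move=> iL; rewrite /Rintegral fineK; last exact: integrable_fin_num.
have setTE : setT = `]-oo, 0%R[%classic `|` `[0%R, +oo[%classic :> set R.
  by rewrite -setCitvl setUv.
rewrite setTE integral_setU_EFin//.
  by rewrite -setTE; apply/measurable_EFinP; exact: measurable_int iL.
by rewrite -setCitvl; exact/disj_setPCl.
Qed.

(** In the extended reals a sum is finite only if its terms are, since
    [-oo + +oo] is [-oo]; and on a half-line where [L] has a constant sign a
    finite integral is absolutely convergent. *)
Lemma integrable_split0 (L : R -> R) : measurable_fun setT L ->
  (forall t, t < 0 -> L t <= 0) -> (forall t, 0 <= t -> 0 <= L t) ->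
  (\int[mu]_(t in `]-oo, 0%R[) (L t)%:E +
   \int[mu]_(t in `[0%R, +oo[) (L t)%:E)%E \is a fin_num ->
  mu.-integrable setT (EFin \o L).
Proof.
move=> mL L0 L1.
have setTE : setT = `]-oo, 0%R[%classic `|` `[0%R, +oo[%classic :> set R.
  by rewrite -setCitvl setUv.
have -> : (\int[mu]_(t in `]-oo, 0%R[) (L t)%:E =
    - \int[mu]_(t in `]-oo, 0%R[) `|(L t)%:E|)%E.
  rewrite -integral_ge0N//; apply: eq_integral => t; rewrite inE/= in_itv/= => t0.
  by rewrite /= ler0_norm ?EFinN ?oppeK//; exact: L0.
have -> : (\int[mu]_(t in `[0%R, +oo[) (L t)%:E =
    \int[mu]_(t in `[0%R, +oo[) `|(L t)%:E|)%E.
  apply: eq_integral => t; rewrite inE/= in_itv/= andbT => t0.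
  by rewrite ger0_norm//; exact: L1.
move=> fin; apply/integrableP; split; first exact/measurable_EFinP.
rewrite setTE ge0_integral_setU//=.
- set A := (X in (X + _)%E); set B := (X in (_ + X)%E).
  have A0 : (0 <= A)%E by exact: integral_ge0.
  have B0 : (0 <= B)%E by exact: integral_ge0.
  move: A0 B0 fin; rewrite -/A -/B; case: A => [a| |]//; case: B => [b| |]// _ _ _.
  exact: ltry.
- rewrite -setTE; apply/measurable_EFinP; exact: measurableT_comp.
- by rewrite -setCitvl; exact/disj_setPCl.
Qed.

Lemma layer_idE Y t : layer P idfun Y 0 t =
  if 0 <= t then tail P Y t else tail P Y t - 1.
Proof.
by rewrite /layer /=; case: leP => _; rewrite ?mulr0 ?mulr1 ?subr0.
Qed.

Lemma expectation_layer Y : P.-integrable setT (EFin \o Y) ->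
  mu.-integrable setT (EFin \o layer P idfun Y 0) /\
  \int[P]_w Y w = choquet P idfun Y.
Proof.
move=> iY; have mY : measurable_fun setT Y.
  by apply/measurable_EFinP; exact: measurable_int iY.
pose Y' : {RV P >-> R} := mfun_Sub (mem_set mY).
have LY : (Y' : T -> R) \in Lfun P 1 by exact/Lfun1_integrable.
have := expectation_cdf_ccdf LY; rewrite expectation_def /=.
set A := (X in (X - _)%E); set B := (X in (_ - X)%E) => EY.
have mL : measurable_fun setT (layer P idfun Y 0).
  by apply: measurable_layer; exact: measurable_tail.
have AE : A = (\int[mu]_(t in `[0%R, +oo[) (layer P idfun Y 0 t)%:E)%E.
  apply: eq_integral => t; rewrite inE/= in_itv/= andbT => t0.
  by rewrite ccdf_tail layer_idE t0.
have BE : (- B = \int[mu]_(t in `]-oo, 0%R[) (layer P idfun Y 0 t)%:E)%E.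
  rewrite -integral_ge0N//; apply: eq_integral => t; rewrite inE/= in_itv/= => t0.
  by rewrite cdf_1_ccdf ccdf_tail layer_idE leNgt t0/= opprB.
have iL : mu.-integrable setT (EFin \o layer P idfun Y 0).
  apply: integrable_split0 => //.
  - by move=> t t0; rewrite layer_idE (leNgt 0 t) t0/= subr_le0 tail_le1.
  - by move=> t t0; rewrite layer_idE t0 tail_ge0.
  - by rewrite -AE -BE addeC -EY; exact: integrable_fin_num.
split => //.
by rewrite {1}/Rintegral EY addeC AE BE integral_split0.
Qed.

(** Only the upper tail matters for the integrability of [max Y z]. *)
Lemma integrable_max_tail Y z : measurable_fun setT Y ->
  (\int[mu]_(t in `[0%R, +oo[) (tail P Y t)%:E < +oo)%E ->
  P.-integrable setT (EFin \o (fun w => Num.max (Y w) z)).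
Proof.
move=> mY fin.
have mY0 : measurable_fun setT (fun w => Num.max (Y w) 0).
  exact: measurable_maxr.
have mYz : measurable_fun setT (fun w => Num.max (Y w) z).
  exact: measurable_maxr.
pose Y' : {RV P >-> R} := mfun_Sub (mem_set mY0).
have iY0 : P.-integrable setT (EFin \o (fun w => Num.max (Y w) 0)).
  apply/integrableP; split; first exact/measurable_EFinP.
  have := @ge0_expectation_ccdf _ _ _ P Y'; rewrite expectation_def.
  have Y'0 w : 0 <= Y' w by rewrite /Y' /= le_max lexx orbT.
  move=> /(_ Y'0) E.
  under eq_integral => w _ do rewrite /= ger0_norm ?(Y'0 w)//.
  rewrite [X in (X < _)%E]E.
  under eq_integral => t.
    rewrite inE/= in_itv/= andbT => t0; rewrite ccdf_tail tail_max_ge//; over.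
  by [].
have iz : P.-integrable setT (EFin \o (fun w => Num.max (Y w) 0 + `|z|)).
  by apply: integrableD_EFin => //; exact: finite_measure_integrable_cst.
apply: le_integrable_EFin iz => // w.
rewrite ler_norml; apply/andP; split.
  rewrite le_max; apply/orP; right.
  rewrite lerNl (le_trans _ (_ : `|z| <= _))// ?ler_normr ?lexx ?orbT//.
  by rewrite lerDr le_max lexx orbT.
rewrite ge_max; apply/andP; split; first by rewrite ler_wpDr// le_max lexx.
by rewrite (le_trans (ler_norm z))// lerDr le_max lexx orbT.
Qed.

End layer.

(** * Stieltjes measures and densities *)

(** The measurability and the sign of [D] are arguments because the measure
    structure below is attached to this constant. *)
Definition density_measure d (T : measurableType d) (R : realType)
  (m : {measure set T -> \bar R}) (D : T -> R)
  (mD : measurable_fun setT D) (D0 : forall x, 0 <= D x) (A : set T) : \bar R :=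
  (\int[m]_(x in A) (D x)%:E)%E.

Section density_measure.
Local Open Scope ereal_scope.
Context d (T : measurableType d) (R : realType) (m : {measure set T -> \bar R}).
Variables (D : T -> R) (mD : measurable_fun setT D).
Hypothesis D0 : (forall x, 0 <= D x)%R.

Local Notation dm := (density_measure m mD D0).

Let dm0 : dm set0 = 0.
Proof. by rewrite /density_measure integral_set0. Qed.

Let dm_ge0 A : 0 <= dm A.
Proof. by apply: integral_ge0 => x _; rewrite lee_fin. Qed.

Let dm_sigma_additive : semi_sigma_additive dm.
Proof.
move=> F mF tF mUF; rewrite /density_measure ge0_integral_bigcup//=.
- apply: is_cvg_ereal_nneg_natsum_cond => n _ _.
  by apply: integral_ge0 => x _; rewrite lee_fin.
- by apply/measurable_EFinP; exact: measurable_funS mD.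
- by move=> x _; rewrite lee_fin.
Qed.

HB.instance Definition _ := isMeasure.Build _ _ _ dm dm0 dm_ge0 dm_sigma_additive.

Import HBNNSimple.

(** True for indicators by hypothesis, hence for simple functions, hence for
    their monotone limits. *)
Lemma ge0_integral_density (nu : {measure set T -> \bar R}) (k : T -> R) :
  (forall A, measurable A -> nu A = \int[m]_(x in A) (D x)%:E) ->
  measurable_fun setT k -> (forall x, 0 <= k x)%R ->
  \int[nu]_x (k x)%:E = \int[m]_x (k x * D x)%:E.
Proof.
move=> nuE mk k0; have mEk : measurable_fun setT (EFin \o k) by exact/measurable_EFinP.
pose h := nnsfun_approx measurableT mEk.
have hk x : (h n x)%:E @[n --> \oo] --> (k x)%:E.
  by apply: (@cvg_nnsfun_approx _ _ _ _ measurableT _ mEk) => // y _; rewrite lee_fin.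
have ndh x : nondecreasing_seq (h ^~ x).
  by move=> a b ab; exact/lefP/nd_nnsfun_approx.
have hn n : \int[nu]_x (h n x)%:E = \int[m]_x (h n x * D x)%:E.
  have mI r : measurable (h n @^-1` [set r]) by [].
  under eq_integral do rewrite fimfunE -fsumEFin//.
  rewrite ge0_integral_fsum//; first last.
  - by move=> r x _; rewrite EFinM nnfun_muleindic_ge0.
  - by move=> r; apply/measurable_EFinP; exact: measurable_funM.
  under [RHS]eq_integral => x _.
    rewrite fimfunE EFinM -fsumEFin// ge0_mule_fsuml; last first.
      by move=> r; rewrite EFinM nnfun_muleindic_ge0.
    over.
  rewrite ge0_integral_fsum//; first last.
  - by move=> r x _; rewrite mule_ge0 ?lee_fin// -lee_fin EFinM nnfun_muleindic_ge0.
  - move=> r; apply/measurable_EFinP; apply: measurable_funM => //.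
    exact: measurable_funM.
  apply: eq_fsbigr => r; rewrite inE => -[y _ <-{r}].
  rewrite integralZl_indic_nnsfun// integral_indic// setIT nuE//.
  under [RHS]eq_integral do rewrite EFinM -muleA.
  rewrite ge0_integralZl//.
  + congr (_ * _); rewrite integral_mkcond; apply: eq_integral => x _.
    by rewrite epatch_indic/= muleC.
  + by apply/measurable_EFinP; exact: measurable_funM.
  + by move=> x _; rewrite mule_ge0// lee_fin.
  + by rewrite lee_fin.
transitivity (limn (fun n => \int[nu]_x (h n x)%:E)).
  rewrite -monotone_convergence//.
  - by apply: eq_integral => x _; apply/esym/cvg_lim => //; exact: hk.
  - by move=> n; exact/measurable_EFinP.
  - by move=> n x _; rewrite lee_fin.
  - by move=> x _ a b ab; rewrite lee_fin ndh.
under eq_fun do rewrite hn.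
rewrite -monotone_convergence//.
- apply: eq_integral => x _; apply/cvg_lim => //.
  by under eq_fun do rewrite EFinM; rewrite EFinM; apply: cvgeZr => //; exact: hk.
- by move=> n; apply/measurable_EFinP; exact: measurable_funM.
- by move=> n x _; rewrite lee_fin mulr_ge0.
- by move=> x _ a b ab; rewrite lee_fin ler_wpM2r// ndh.
Qed.

End density_measure.

Section cumulative_measures.
Context (R : realType) (f : R -> R).
Hypotheses (ndf : {homo f : x y / x <= y}) (cf : continuous f).
Notation mu := (@lebesgue_measure R).

Let rcf : right_continuous f. Proof. exact: right_continuousW. Qed.

Let F : cumulative R R := HB.pack f (isCumulative.Build _ _ _ f ndf rcf).

Definition stieltjes := lebesgue_stieltjes_measure F.

HB.instance Definition _ := Measure.on stieltjes.

Lemma stieltjes_itvoc a b : a <= b -> stieltjes `]a, b]%classic = (f b - f a)%:E.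
Proof.
move=> ab; rewrite /stieltjes /lebesgue_stieltjes_measure /measure_extension.
by rewrite measurable_mu_extE/= ?wlength_itv_bnd//; exact: is_ocitv.
Qed.

(** Half-open intervals determine a measure that is finite on them. *)
Lemma eq_stieltjes (m : {measure set (measurableTypeR R) -> \bar R}) :
  (forall a b, a <= b -> m `]a, b]%classic = (f b - f a)%:E) ->
  forall A, measurable A -> stieltjes A = m A.
Proof.
move=> mE; apply: lebesgue_stieltjes_measure_unique => _ [[a b] _ <-]/=.
have [ab|ba] := leP a b; first by rewrite mE//; exact: stieltjes_itvoc.
by rewrite set_itv_ge ?measure0// bnd_simp -leNgt ltW.
Qed.

End cumulative_measures.

(** * Absolute continuity of the shares *)

Section nonexpansive.
Context (R : realType).
Implicit Types (f D : R -> R).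
Notation mu := (@lebesgue_measure R).

(** The increments of the other functions are non-negative too. *)
Lemma comonotone_nonexpansive n (f : 'I_n -> R -> R) :
  (forall i, {homo f i : x y / x <= y}) -> (forall x, \sum_(i < n) f i x = x) ->
  forall i x y, x <= y -> f i y - f i x <= y - x.
Proof.
move=> ndf sumf i x y xy.
rewrite -[X in _ <= X - _]sumf -[X in _ <= _ - X]sumf -sumrB (bigD1 i)//=.
by rewrite lerDl sumr_ge0// => k _; rewrite subr_ge0 ndf.
Qed.

Lemma nonexpansive_continuous f : {homo f : x y / x <= y} ->
  (forall a b, a <= b -> f b - f a <= b - a) -> continuous f.
Proof.
move=> ndf lipf x; apply/cvgrPdist_le => e e0.
near=> y.
have xy : `|x - y| <= e by near: y; exact: cvgr_dist_le.
apply: le_trans xy; have [|/ltW] := leP x y => h.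
  by rewrite !ler0_norm ?subr_le0// ?ndf// !opprB lipf.
by rewrite !ger0_norm ?subr_ge0// ?ndf// lipf.
Unshelve. all: by end_near. Qed.

Section density.
Variable f : R -> R.
Hypothesis ndf : {homo f : x y / x <= y}.
Hypothesis lipf : forall a b, a <= b -> f b - f a <= b - a.

Let cf : continuous f := nonexpansive_continuous ndf lipf.

Let nu : {measure set (measurableTypeR R) -> \bar R} := stieltjes ndf cf.

(** [f] and [id - f] are both non-decreasing, and their Stieltjes measures add
    up to the Lebesgue measure. *)
Lemma stieltjes_le_lebesgue A : measurable A -> (nu A <= mu A)%E.
Proof.
move=> mA; pose f' x := x - f x.
have ndf' : {homo f' : x y / x <= y}.
  by move=> x y /lipf; rewrite /f'; lra.
have lipf' a b : a <= b -> f' b - f' a <= b - a.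
  by move=> /ndf; rewrite /f'; lra.
have cf' := nonexpansive_continuous ndf' lipf'.
have cid : continuous (@idfun R) by move=> x; exact: cvg_id.
have ndid : {homo (@idfun R) : x y / x <= y} by [].
have -> : mu A = measure_add nu (stieltjes ndf' cf') A.
  rewrite -(@eq_stieltjes _ _ ndid cid mu)//; last first.
    move=> a b ab; rewrite [LHS](_ : _ = mu `]a, b]%classic)//.
    rewrite lebesgue_measure_itv/= lte_fin.
    by move: ab; rewrite le_eqVlt => /predU1P[->|->]; rewrite ?ltxx ?subrr.
  apply: eq_stieltjes => // a b ab.
  rewrite [LHS]measure_addE [X in (X + _)%E]stieltjes_itvoc//.
  rewrite [X in (_ + X)%E]stieltjes_itvoc//.
  by rewrite -EFinD /f'; congr (_%:E) => /=; ring.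
by rewrite [leRHS]measure_addE leeDl.
Qed.

Let window (m : nat) : set (measurableTypeR R) := `]- m%:R, m%:R]%classic.

(** The Radon-Nikodym theorem, applied to the restriction of [nu] to a bounded
    window because [nu] may be infinite. *)
Lemma local_density (m : nat) : exists g : R -> R,
  [/\ mu.-integrable setT (EFin \o g), forall x, 0 <= g x &
  forall A, measurable A -> nu (A `&` window m) = (\int[mu]_(x in A) (g x)%:E)%E].
Proof.
have mI : measurable (window m) by exact: measurable_itv.
have Ifin : (nu (window m) < +oo)%E.
  by rewrite [ltLHS]stieltjes_itvoc ?ltry// ge0_cp// ler0n.
have dom : mfrestr mI Ifin `<< mu.
  apply/null_content_dominatesP => A mA A0.
  apply/eqP; rewrite eq_le measure_ge0 andbT -A0.
  apply: le_trans (stieltjes_le_lebesgue mA).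
  by apply: le_measure; rewrite ?inE//; exact: measurableI.
have [g [g0 gfin ig gE]] := radon_nikodym_sigma_finite dom.
exists (fine \o g); split.
- by apply: eq_integrable ig => // x _ /=; rewrite fineK.
- by move=> x; rewrite fine_ge0.
- move=> A mA; rewrite -[LHS]/(mfrestr mI Ifin A) gE//.
  by apply: eq_integral => x _; rewrite /= fineK.
Qed.

(** By Lebesgue's differentiation theorem, since inside the window the integral
    of the density is [f] up to a constant. *)
Lemma local_density_derive1 (m : nat) (g : R -> R) :
  mu.-integrable setT (EFin \o g) ->
  (forall A, measurable A -> nu (A `&` window m) = (\int[mu]_(x in A) (g x)%:E)%E) ->
  {ae mu, forall x, - m%:R < x < m%:R -> derivable f x 1 /\ derive1 f x = g x}.
Proof.
move=> ig gE.
have loc : locally_integrable setT g.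
  by apply: open_integrable_locally => //; exact: openT.
pose G x := \int[mu]_(t in [set` Interval (BRight (- m%:R)) (BRight x)]) g t.
have GE x : - m%:R <= x <= m%:R -> G x = f x - f (- m%:R).
  move=> /andP[mx xm]; rewrite /G /Rintegral -gE// setIidl; last first.
    by apply: subset_itvl; rewrite bnd_simp.
  by rewrite [X in fine X]stieltjes_itvoc.
have := FTC1 (a := BRight (- m%:R)) _ loc.
have iy y : mu.-integrable [set` Interval (BRight (- m%:R)) (BRight y)] (EFin \o g).
  exact: integrableS ig.
move=> /(_ iy); apply: filterS; first exact: (ae_filter_ringOfSetsType mu).
move=> x /= dx /andP[mx xm].
have mx' : (BRight (- m%:R) < BRight x)%O by rewrite bnd_simp.
have [dG <-] := dx mx'; rewrite !derive1E.
have fG : \forall y \near x, f y = (G + cst (f (- m%:R))) y.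
  near=> y; rewrite /= fctE GE ?subrK//.
  by apply/andP; split; apply/ltW; near: y; [exact: lt_nbhsr|exact: lt_nbhsl].
have dGc : derivable (G + cst (f (- m%:R))) x 1 by exact: derivableD.
split; last by rewrite (near_eq_derive _ fG) deriveD// derive_cst addr0.
by apply: near_eq_derivable dGc; near do apply/esym.
Unshelve. all: by end_near. Qed.

(** The local densities agree with [derive1 f] almost everywhere on growing
    windows; their upper limit is a version of the derivative that is
    measurable and non-negative everywhere. *)
Lemma nonexpansive_density : exists D : R -> R,
  [/\ measurable_fun setT D, forall x, 0 <= D x,
  forall a b, a <= b -> (\int[mu]_(x in `]a, b]) (D x)%:E)%E = (f b - f a)%:E &
  {ae mu, forall x, derivable f x 1 /\ derive1 f x = D x}].
Proof.
have /choice[g gP] := local_density.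
have ig m : mu.-integrable setT (EFin \o g m) by have [] := gP m.
have g0 m x : 0 <= g m x by have [] := gP m.
have gE m A (mA : measurable A) := let: And3 _ _ h := gP m in h A mA.
have mg m : measurable_fun setT (EFin \o g m) by exact: measurable_int (ig m).
pose D (x : R) : R := `|fine (limn_esup (fun m => (g m x)%:E))|.
have ae_g : {ae mu, forall x, forall m, - m%:R < x < m%:R ->
    derivable f x 1 /\ derive1 f x = g m x}.
  apply: ae_foralln => m; apply: local_density_derive1 => [|A mA]; first exact: ig.
  exact: gE.
have big_enough (x : R) : exists m : nat, `|x| < m%:R.
  by exists (Num.bound `|x|); exact: archi_boundP.
have ae_D : {ae mu, forall x, forall m, - m%:R < x < m%:R ->
    [/\ derivable f x 1, derive1 f x = g m x & derive1 f x = D x]}.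
  move: ae_g; apply: filterS; first exact: (ae_filter_ringOfSetsType mu).
  move=> x gx m xm; have [df fg] := gx m xm; split=> //.
  have cg : (fun m => (g m x)%:E) @ \oo --> (derive1 f x)%:E.
    apply: cvg_near_cst; have [k xk] := big_enough x.
    near=> p; rewrite -(gx p _).2//.
    have kp : k%:R <= p%:R :> R by rewrite ler_nat; near: p; exact: nbhs_infty_ge.
    by rewrite -ltr_norml (lt_le_trans xk).
  rewrite /D is_cvg_limn_esupE; last by apply/cvg_ex; exists (derive1 f x)%:E.
  by rewrite (cvg_lim _ cg)//= fg ger0_norm.
have mD : measurable_fun setT D.
  apply: measurableT_comp => //; apply: measurableT_comp; first exact: fine_measurable.
  exact: measurable_fun_limn_esup.
exists D; split => [//|x|a b ab|].
- exact: normr_ge0.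
- have [m [am bm]] : exists m : nat, - m%:R < a /\ b < m%:R.
    have [k ak] := big_enough a; have [l bl] := big_enough b.
    exists (maxn k l); split.
      rewrite ltrNl (le_lt_trans _ (lt_le_trans ak _))//; last by rewrite ler_nat leq_maxl.
      by rewrite -normrN ler_norm.
    by rewrite (le_lt_trans (ler_norm b))// (lt_le_trans bl)// ler_nat leq_maxr.
  have <- : (\int[mu]_(x in `]a, b]) (g m x)%:E)%E = (f b - f a)%:E.
    rewrite -gE// setIidl; first exact: stieltjes_itvoc.
    by apply: subset_itv; rewrite bnd_simp ltW.
  apply: ae_eq_integral => //.
  + by apply: measurable_funTS; apply/measurable_EFinP.
  + apply: measurable_funTS; exact: mg.
  move: ae_D; apply: filterS; first exact: (ae_filter_ringOfSetsType mu).
  move=> x /(_ m) gD /=; rewrite in_itv/= => /andP[ax xb].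
  have [] := gD _; first by rewrite (lt_trans am ax) (le_lt_trans xb bm).
  by move=> _ <- <-.
- move: ae_D; apply: filterS; first exact: (ae_filter_ringOfSetsType mu).
  move=> x; have [k] := big_enough x; rewrite ltr_norml => xk.
  by move=> /(_ k xk)[].
Unshelve. all: by end_near. Qed.

End density.

End nonexpansive.

(** * Substitution in Choquet integrals *)

(** The substitution [y = f x] for a function [f] that may be constant on
    intervals. Lebesgue measure on the range of [f] is carried by the generalised
    inverse of [f] to the Stieltjes measure of [f], which has density [D]. *)
Section change_of_variables.
Context (R : realType) (f D : R -> R).
Notation mu := (@lebesgue_measure R).
Hypotheses (ndf : {homo f : x y / x <= y}) (cf : continuous f).
Hypotheses (mD : measurable_fun setT D) (D0 : forall x, 0 <= D x).
Hypothesis DE : forall a b, a <= b ->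
  (\int[mu]_(x in `]a, b]) (D x)%:E)%E = (f b - f a)%:E.

(** The values [y] that [f] crosses. The layers of [f (X)], taken with
    the reference level [f 0], vanish at the other values. *)
Let between : set (measurableTypeR R) := [set y | exists a b, f a <= y < f b].

Let gen_inverse y : R := sup [set x | f x <= y].

Let has_sup_between y : between y -> has_sup [set x | f x <= y].
Proof.
move=> [a [b /andP[ay yb]]]; split; first by exists a.
exists b => z /= zy; rewrite leNgt; apply/negP => /ltW /ndf.
by rewrite leNgt (le_lt_trans zy yb).
Qed.

Let f_gen_inverse y : between y -> f (gen_inverse y) = y.
Proof.
move=> yP; have hE := has_sup_between yP; have [a [b /andP[ay yb]]] := yP.
have ab : a <= b by rewrite leNgt; apply/negP => /ltW /ndf; rewrite leNgt (le_lt_trans ay yb).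
apply/eqP; rewrite eq_le; apply/andP; split.
  apply: (@preimage_closed _ _ f [set z | z <= y] _ (@closed_le _ y)).
    by move=> x _; exact: cf.
  exact: closure_sup hE.1 hE.2.
have [|c _ fc] := @IVT _ f a b y ab (continuous_subspaceT cf).
  by rewrite ge_min ay/= le_max (ltW yb) orbT.
rewrite -[leLHS]fc; apply: ndf; apply: sup_upper_bound => //=.
by rewrite fc.
Qed.

(** The Galois connection between [f] and its generalised inverse: it
    identifies the event [y < f (X)] with [gen_inverse y < X]. *)
Let gen_inverse_lt y x : between y -> (gen_inverse y < x) = (y < f x).
Proof.
move=> yP; apply/idP/idP => [qx|yx].
  rewrite ltNge; apply/negP => xy.
  by have := sup_upper_bound (has_sup_between yP) xy; rewrite leNgt qx.
by rewrite ltNge; apply/negP => /ndf; rewrite f_gen_inverse// leNgt yx.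
Qed.

Let measurable_between : measurable between.
Proof.
apply: is_interval_measurable => x y [a [b /andP[ax _]]] [a' [b' /andP[_ yb]]].
by move=> z /andP[xz zy]; exists a, b'; rewrite (le_trans ax xz) (le_lt_trans zy yb).
Qed.

Let q : measurableTypeR R -> measurableTypeR R := gen_inverse \_ between.

Let measurable_q : measurable_fun setT q.
Proof.
apply/(measurable_restrictT _ measurable_between).
apply: (measurability (@RGenInftyO.G R)) => [|/= _ [_] [r] -> <-].
  exact: RGenInftyO.measurableE.
rewrite [X in measurable X](_ : _ = between `&` `]-oo, f r[); first exact: measurableI.
by apply/seteqP; split => y /= [yP]; rewrite !in_itv/= gen_inverse_lt.
Qed.

Lemma integral_gen_inverse (k : R -> R) : measurable_fun setT k ->
  (forall x, 0 <= k x) ->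
  (\int[mu]_(y in between) (k (gen_inverse y))%:E)%E = (\int[mu]_x (k x * D x)%:E)%E.
Proof.
move=> mk k0.
pose m : {measure set (measurableTypeR R) -> \bar R} :=
  measure_function_pushforward__canonical__measure_function_Measure
    (mrestr mu measurable_between) measurable_q.
have mE (a b : R) : a <= b -> m `]a, b]%classic = (f b - f a)%:E.
  move=> ab; rewrite /m /= /pushforward /mrestr.
  have qE y : between y -> q y = gen_inverse y by move=> yP; rewrite /q patchE mem_set.
  have len b0 b1 : mu [set` Interval (BSide b0 (f a)) (BSide b1 (f b))] = (f b - f a)%:E.
    rewrite lebesgue_measure_itv/= lte_fin.
    by move: (ndf ab); rewrite le_eqVlt => /predU1P[->|->]; rewrite ?ltxx ?subrr.
  have mS : measurable (q @^-1` `]a, b] `&` between).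
    by apply: measurableI => //; rewrite -[X in measurable X]setTI; exact: measurable_q.
  apply/eqP; rewrite eq_le; apply/andP; split.
    rewrite -[leRHS](len true false); apply: le_measure; rewrite ?inE//.
    move=> y [/= + yP]; rewrite qE// !in_itv/= => /andP[aq qb].
    by rewrite -(f_gen_inverse yP) !ndf// ltW.
  rewrite -[leLHS](len false true); apply: le_measure; rewrite ?inE//.
  move=> y /=; rewrite !in_itv/= => /andP[ay yb].
  have yP : between y by exists a, b; rewrite (ltW ay) yb.
  split => //; rewrite /= qE// andbC ltW ?gen_inverse_lt//=.
  by rewrite ltNge; apply/negP => /ndf; rewrite f_gen_inverse// leNgt ay.
have mDE A : measurable A -> m A = (\int[mu]_(x in A) (D x)%:E)%E.
  move=> mA; rewrite -(eq_stieltjes ndf cf mE)//.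
  by rewrite (@eq_stieltjes _ _ ndf cf (density_measure mu mD D0)).
rewrite -(@ge0_integral_density _ (measurableTypeR R) _ mu D mD D0 m k mDE mk k0).
rewrite ge0_integral_pushforward//; last first.
- by move=> y _; rewrite lee_fin.
- exact/measurable_EFinP.
rewrite preimage_setT.
rewrite (@ge0_integral_density _ (measurableTypeR R) _ mu (\1_between) _ _ _ (k \o q))//.
- rewrite [LHS]integral_mkcond; apply: eq_integral => y _; rewrite [LHS]patchE indicE /q /=.
  by rewrite patchE; case: ifP => _; rewrite ?mulr1 ?mulr0.
- by move=> A mA; rewrite integral_indic// setIC.
- exact: measurableT_comp.
- by move=> y; exact: k0.
Qed.

Context d (T : measurableType d) (P : probability T R).
Variables (h : R -> R) (X : T -> R).
Hypothesis h0 : h 0 = 0.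
Hypothesis mh : measurable_fun setT (h \o tail P X).

Let k := layer P h X 0.
Let L := layer P h (f \o X) (f 0).

Let LE y : L y = if y \in between then k (gen_inverse y) else 0.
Proof.
case: ifPn => [|]; rewrite ?inE ?notin_setE => yP.
  rewrite /L /k /layer gen_inverse_lt//; congr (h (fine (P _)) - _).
  by apply/seteqP; split => w /=; rewrite gen_inverse_lt.
rewrite /L /layer; have [[a ay]|aN] := pselect (exists a, f a <= y).
  have fy b : f b <= y.
    by rewrite leNgt; apply/negP => yb; apply: yP; exists a, b; rewrite ay yb.
  rewrite (ltNge y) fy mulr0 subr0 /tail (_ : [set _ | _] = set0) ?measure0//.
  by apply/seteqP; split => // w /=; rewrite ltNge fy.
have fy b : y < f b by rewrite ltNge; apply/negP => yb; apply: aN; exists b.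
rewrite fy mulr1 /tail (_ : [set _ | _] = setT) ?probability_setT ?subrr//.
by apply/seteqP; split => // w /=; rewrite fy.
Qed.

Let integral_L (phi : R -> R) : measurable_fun setT phi ->
  (forall x, 0 <= phi x) -> phi 0 = 0 ->
  (\int[mu]_y (phi (L y))%:E = \int[mu]_x (phi (k x) * D x)%:E)%E.
Proof.
move=> mphi phi0 phi00.
have mphik : measurable_fun setT (phi \o k).
  by apply: measurableT_comp mphi _; exact: measurable_layer.
rewrite -(@integral_gen_inverse (phi \o k))//; last by move=> x; exact: phi0.
rewrite [RHS]integral_mkcond; apply: eq_integral => y _.
by rewrite LE [RHS]patchE; case: ifP => //=; rewrite phi00.
Qed.

Let mL : measurable_fun setT L.
Proof.
have mk : measurable_fun setT k by exact: measurable_layer.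
rewrite (_ : L = (k \o q) \_ between).
  apply/(measurable_restrictT _ measurable_between); apply: measurable_funTS.
  exact: measurableT_comp measurable_q.
by apply/funext => y; rewrite LE patchE /=; case: ifPn => // yP; rewrite /q patchE yP.
Qed.

Lemma integrable_layer_comp :
  mu.-integrable setT (EFin \o (fun t => k t * D t)) <->
  mu.-integrable setT (EFin \o L).
Proof.
have mkD : measurable_fun setT (fun t => k t * D t).
  by apply: measurable_funM => //; exact: measurable_layer.
have absE : (\int[mu]_y `|(L y)%:E| = \int[mu]_y `|(k y * D y)%:E|)%E.
  rewrite (@integral_L (@Num.norm R R))//; last exact: normr0.
  by apply: eq_integral => y _; rewrite /= normrM (ger0_norm (D0 y)).
split => /integrableP[_ fin]; apply/integrableP; split.
- exact/measurable_EFinP.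
- by rewrite absE.
- exact/measurable_EFinP.
- by rewrite -absE.
Qed.

Lemma Rintegral_layer_comp : mu.-integrable setT (EFin \o (fun t => k t * D t)) ->
  \int[mu]_t L t = \int[mu]_t (k t * D t).
Proof.
move=> ikD; have iL := integrable_layer_comp.1 ikD.
have iaL : mu.-integrable setT (EFin \o (fun t => `|L t|)) by exact: integrable_norm.
have iakD : mu.-integrable setT (EFin \o (fun t => `|k t * D t|)) by exact: integrable_norm.
(* [integral_L] applies to non-negative functions only; both [`|x|] and
   [`|x| + x] are non-negative, and their difference is [x]. *)
have : \int[mu]_t (`|L t| + L t) = \int[mu]_t (`|k t * D t| + k t * D t).
  rewrite /Rintegral (@integral_L (fun x => `|x| + x)).
  - by congr fine; apply: eq_integral => t _; rewrite normrM (ger0_norm (D0 t)) mulrDl.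
  - exact: measurable_funD.
  - by move=> x; have := ler_norm (- x); rewrite normrN; lra.
  - by rewrite normr0 addr0.
have : \int[mu]_t `|L t| = \int[mu]_t `|k t * D t|.
  rewrite /Rintegral (@integral_L (@Num.norm R R))//; last exact: normr0.
  by congr fine; apply: eq_integral => y _; rewrite /= normrM (ger0_norm (D0 y)).
rewrite (RintegralD measurableT iaL iL) (RintegralD measurableT iakD ikD) => ->.
exact: addrI.
Qed.

End change_of_variables.

(** * Concave functions on the unit interval *)

Definition concave01 (R : realType) (h : R -> R) :=
  forall x y t, 0 <= x <= 1 -> 0 <= y <= 1 -> 0 <= t <= 1 ->
  t * h x + (1 - t) * h y <= h (t * x + (1 - t) * y).

Section interpolation.
Context (R : realType) (h : R -> R).
Hypotheses (ch : concave01 h) (h0 : h 0 = 0).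

Section grid.
Variable N : nat.

Definition node (j : nat) : R := j%:R / N.+1%:R.

Definition slope j : R := N.+1%:R * (h (node j.+1) - h (node j)).

(** The interpolation of [h] at the first [m + 1] nodes, constant beyond them.
    Writing it with increments of the functions [Num.min s (node j)] prepares
    the summation by parts of [subadditive_interp]. *)
Definition interp m s : R :=
  \sum_(j < m) slope j * (Num.min s (node j.+1) - Num.min s (node j)).

Lemma node_ge0 j : 0 <= node j.
Proof. by rewrite divr_ge0. Qed.

Lemma le_node j k : (j <= k)%N -> node j <= node k.
Proof. by move=> jk; rewrite ler_pM2r ?invr_gt0// ler_nat. Qed.

Lemma node0 : node 0 = 0. Proof. by rewrite /node mul0r. Qed.

Lemma nodeN : node N.+1 = 1. Proof. by rewrite /node divff. Qed.

Lemma nodeS j : node j.+1 = node j + N.+1%:R^-1.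
Proof. by rewrite /node -natr1 mulrDl mul1r. Qed.

Lemma node_itv j : (j <= N.+1)%N -> 0 <= node j <= 1.
Proof. by move=> jN; rewrite node_ge0 -nodeN le_node. Qed.

(** Concavity at the midpoint of two consecutive cells. *)
Lemma slope_nonincreasing j : (j.+2 <= N.+1)%N -> slope j.+1 <= slope j.
Proof.
move=> jN; rewrite /slope ler_pM2l//.
have := @ch (node j) (node j.+2) 2^-1 (node_itv (ltnW (ltnW jN))) (node_itv jN).
have -> : 2^-1 * node j + (1 - 2^-1) * node j.+2 = node j.+1.
  by rewrite !nodeS; move: (node j) (N.+1%:R^-1) => x e; lra.
by move=> /(_ ltac:(lra)); lra.
Qed.

Lemma interp_node m s : node m <= s -> interp m s = h (node m).
Proof.
elim: m => [|m IH] ms; first by rewrite /interp big_ord0 node0 h0.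
have ms' : node m <= s by rewrite (le_trans _ ms)// le_node.
rewrite /interp big_ord_recr/= -/(interp m s) IH// !min_r// /slope.
have -> : node m.+1 - node m = N.+1%:R^-1 by rewrite nodeS addrC addKr.
by rewrite mulrAC divff ?pnatr_eq0// mul1r addrC subrK.
Qed.

Lemma interp_cell m s : (m <= N)%N -> node m <= s <= node m.+1 ->
  interp N.+1 s = h (node m) + slope m * (s - node m).
Proof.
move=> mN /andP[ms sm].
have step k : (m.+1 <= k)%N -> interp k s = interp m.+1 s.
  elim: k => // k IH; rewrite ltnS leq_eqVlt => /predU1P[->//|mk].
  rewrite /interp big_ord_recr/= -/(interp k s) IH// !min_l ?subrr ?mulr0 ?addr0//.
    by rewrite (le_trans sm)// le_node.
  by rewrite (le_trans sm)// le_node// ltnW.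
by rewrite step// /interp big_ord_recr/= -/(interp m s) interp_node// min_l// min_r.
Qed.

Lemma cell s : 0 <= s <= 1 -> exists2 m, (m <= N)%N & node m <= s <= node m.+1.
Proof.
move=> /andP[s0 s1].
have : exists m, s <= node m.+1 by exists N; rewrite nodeN.
move=> /ex_minnP[m sm mmin].
have mN : (m <= N)%N by apply: mmin; rewrite nodeN.
exists m => //; rewrite sm andbT; case: m sm mmin mN => [|m] sm mmin mN.
  by rewrite node0.
by rewrite leNgt; apply/negP => /ltW /mmin; rewrite ltnn.
Qed.

(** The form in which concavity applies: Jensen's inequality bounds the
    interpolation by [h s], and lower bounds for [h] near [s] pass to it. *)
Lemma interp_conv s : 0 <= s <= 1 -> exists a b t,
  [/\ [/\ 0 <= a <= 1, 0 <= b <= 1 & 0 <= t <= 1],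
      a <= s <= b /\ b = a + N.+1%:R^-1,
      s = t * a + (1 - t) * b &
      interp N.+1 s = t * h a + (1 - t) * h b].
Proof.
move=> /cell[m mN mP].
have N0 : 0 < N.+1%:R :> R by [].
rewrite (interp_cell mN mP) /slope.
have mN1 : (m.+1 <= N.+1)%N by [].
have := node_itv mN1; have := node_itv (leqW mN); move: mP; rewrite nodeS.
move: (node m) (N.+1%:R) N0 => a e e0 /andP[sa sb] a01 b01.
exists a, (a + e^-1), (e * (a + e^-1 - s)); split => //.
- split => //; apply/andP; split; first by rewrite mulr_ge0 ?subr_ge0// ltW.
  by rewrite -ler_pdivlMl// mulr1; lra.
- by rewrite sa sb.
- by field; rewrite gt_eqF.
- by field; rewrite gt_eqF.
Qed.

Lemma interp_le s : 0 <= s <= 1 -> interp N.+1 s <= h s.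
Proof.
move=> /interp_conv[a [b [t [[a01 b01 t01] _ sE ->]]]]; rewrite [in leRHS]sE.
exact: ch.
Qed.

Lemma interp1 : interp N.+1 1 = h 1.
Proof. by rewrite interp_node nodeN. Qed.

Lemma interp_ge_chord s : 0 <= s <= 1 -> h 1 * s <= interp N.+1 s.
Proof.
move=> /interp_conv[a [b [t [[a01 b01 t01] _ sE ->]]]].
have chord x : 0 <= x <= 1 -> h 1 * x <= h x.
  move=> x01; have := @ch 1 0 x _ _ x01.
  rewrite h0 !mulr0 !addr0 mulr1 mulrC; apply; rewrite ?lexx ?ler01//.
have /andP[t0 t1] := t01.
rewrite {1}sE mulrDr !(mulrCA (h 1)) lerD// ler_wpM2l ?chord// subr_ge0//.
Qed.

End grid.

(** A concave function loses at most a multiple of the distance when moving away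
    from an interior point. At the ends of the unit interval, where [h] may
    jump, the interpolation is exact. *)
Lemma interp_cvg s : 0 <= s <= 1 -> interp N N.+1 s @[N --> \oo] --> h s.
Proof.
move=> s01; have /andP[s0 s1] := s01.
have [->|sn0] := eqVneq s 0.
  have E N : interp N N.+1 0 = h 0.
    by rewrite (@interp_cell _ 0)// ?node0 ?subrr ?mulr0 ?addr0// lexx node_ge0.
  by under eq_fun do rewrite E; exact: cvg_cst.
have [->|sn1] := eqVneq s 1.
  by under eq_fun do rewrite interp1; exact: cvg_cst.
have s_gt0 : 0 < s by rewrite lt_neqAle eq_sym sn0.
have s_lt1 : s < 1 by rewrite lt_neqAle sn1.
(* To the left of [s] the function [h] lies above its chord from 0 to [s], to
   the right above its chord from [s] to 1; [C] bounds the two slopes. *)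
pose C := `|h s| / s + `|h 1 - h s| / (1 - s).
have C0 : 0 <= C by rewrite addr_ge0// divr_ge0// subr_ge0.
have lb N : h s - C * N.+1%:R^-1 <= interp N N.+1 s.
  have [a [b [t [[a01 b01 t01] [/andP[as_ sb] bE] sE ->]]]] := interp_conv N s01.
  have N0 : 0 < N.+1%:R^-1 :> R by rewrite invr_gt0.
  move: N0 bE; move: (N.+1%:R^-1) => e e0 bE.
  have small x c : 0 <= x <= e -> 0 <= c -> c <= C -> x * c <= C * e.
    by move=> /andP[x0 xe] c0 cC; rewrite mulrC ler_pM.
  have ha : h s - C * e <= h a.
    have as1 : 0 <= a / s <= 1.
      by rewrite divr_ge0//=; [rewrite ler_pdivrMr ?mul1r|case/andP: a01].
    have := @ch s 0 (a / s) s01 _ as1; rewrite lexx ler01 h0 !mulr0 !addr0.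
    rewrite divfK// => /(_ isT); apply: le_trans.
    have -> : a / s * h s = h s - (s - a) * (h s / s) by field.
    rewrite lerD2l lerN2 (le_trans _ (small (s - a) (`|h s| / s) _ _ _))//.
    - by rewrite ler_wpM2l ?subr_ge0// ler_wpM2r ?invr_ge0// ler_norm.
    - by rewrite subr_ge0 as_/=; lra.
    - by rewrite divr_ge0.
    - by rewrite lerDl divr_ge0// subr_ge0.
  have hb : h s - C * e <= h b.
    have s1' : 0 < 1 - s by rewrite subr_gt0.
    have bs1 : 0 <= (b - s) / (1 - s) <= 1.
      rewrite divr_ge0 ?subr_ge0//= ler_pdivrMr// mul1r lerD2r.
      by case/andP: b01.
    have := @ch 1 s ((b - s) / (1 - s)) _ s01 bs1; rewrite lexx ler01 => /(_ isT).
    have -> : (b - s) / (1 - s) * 1 + (1 - (b - s) / (1 - s)) * s = b.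
      by field; rewrite gt_eqF.
    apply: le_trans.
    have -> : (b - s) / (1 - s) * h 1 + (1 - (b - s) / (1 - s)) * h s =
        h s - (b - s) * ((h s - h 1) / (1 - s)) by field; rewrite gt_eqF.
    rewrite lerD2l lerN2 (le_trans _ (small (b - s) (`|h 1 - h s| / (1 - s)) _ _ _))//.
    - rewrite ler_wpM2l ?subr_ge0// ler_wpM2r ?invr_ge0 ?subr_ge0//.
      by rewrite distrC ler_norm.
    - by rewrite subr_ge0 sb/=; lra.
    - by rewrite divr_ge0 ?subr_ge0.
    - by rewrite lerDr divr_ge0.
  move: t01 ha hb => /andP[t0 t1]; move: (h s - C * e) (h a) (h b) => v u w.
  by clear -t0 t1; nra.
have cvgC : h s - C * N.+1%:R^-1 @[N --> \oo] --> h s.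
  rewrite -[X in _ --> X]subr0 -[X in _ --> _ - X](mulr0 C).
  apply: cvgB; first exact: cvg_cst.
  apply: cvgM; first exact: cvg_cst.
  by apply: cvg_harmonic.
apply: (squeeze_cvgr _ cvgC (cvg_cst _)).
by apply: nearW => N; rewrite lb interp_le.
Qed.

End interpolation.

(** * Subadditivity of concave Choquet integrals *)

Section subadditivity.
Context d (T : measurableType d) (R : realType) (P : probability T R).
Notation mu := (@lebesgue_measure R).
Implicit Types (Y Z : T -> R) (h phi : R -> R).

Let mRV Y : P.-integrable setT (EFin \o Y) -> measurable_fun setT Y.
Proof. by move=> iY; apply/measurable_EFinP; exact: measurable_int iY. Qed.

Let tail01 Y t : measurable_fun setT Y -> 0 <= tail P Y t <= 1.
Proof. by move=> mY; rewrite tail_ge0 tail_le1. Qed.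

(** Asking for integrability together with the inequality makes the class stable
    under sums and non-negative multiples. *)
Definition subadditive_distortion phi :=
  (forall Y, P.-integrable setT (EFin \o Y) ->
     mu.-integrable setT (EFin \o layer P phi Y 0)) /\
  (forall n (Z : 'I_n -> T -> R), (forall i, P.-integrable setT (EFin \o Z i)) ->
     choquet P phi (fun w => \sum_(i < n) Z i w) <= \sum_(i < n) choquet P phi (Z i)).

Lemma eq_layer phi phi' Y z : measurable_fun setT Y ->
  (forall s, 0 <= s <= 1 -> phi s = phi' s) -> layer P phi Y z = layer P phi' Y z.
Proof.
move=> mY E; apply/funext => t; rewrite /layer !E ?tail01//.
by rewrite ler01 lexx.
Qed.

Lemma eq_subadditive_distortion phi phi' :
  (forall s, 0 <= s <= 1 -> phi s = phi' s) ->
  subadditive_distortion phi -> subadditive_distortion phi'.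
Proof.
move=> E [iphi sphi]; split => [Y iY|n Z iZ].
  by rewrite -(eq_layer _ _ E) ?iphi//; exact: mRV.
have iS : P.-integrable setT (EFin \o (fun w => \sum_(i < n) Z i w)).
  exact: integrable_sum_EFin.
have := sphi n Z iZ; rewrite /choquet -(eq_layer _ (mRV iS) E).
by under [in X in _ -> X]eq_bigr => i _ do rewrite -(eq_layer _ (mRV (iZ i)) E).
Qed.

Lemma subadditive_distortionD phi phi' : subadditive_distortion phi ->
  subadditive_distortion phi' -> subadditive_distortion (fun s => phi s + phi' s).
Proof.
move=> [iphi sphi] [iphi' sphi'].
have layerD Y : layer P (fun s => phi s + phi' s) Y 0 =
    fun t => layer P phi Y 0 t + layer P phi' Y 0 t.
  by apply/funext => t; rewrite /layer; ring.
have choquetD Y : P.-integrable setT (EFin \o Y) ->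
    choquet P (fun s => phi s + phi' s) Y = choquet P phi Y + choquet P phi' Y.
  move=> iY; rewrite /choquet layerD.
  by rewrite (RintegralD measurableT (iphi _ iY) (iphi' _ iY)).
split => [Y iY|n Z iZ].
  by rewrite layerD; exact: integrableD_EFin (iphi _ iY) (iphi' _ iY).
rewrite choquetD; last exact: integrable_sum_EFin.
under [leRHS]eq_bigr => i _ do rewrite choquetD//.
by rewrite big_split lerD// ?sphi ?sphi'.
Qed.

Lemma subadditive_distortionZ c phi : 0 <= c -> subadditive_distortion phi ->
  subadditive_distortion (fun s => c * phi s).
Proof.
move=> c0 [iphi sphi].
have layerZ Y : layer P (fun s => c * phi s) Y 0 = fun t => c * layer P phi Y 0 t.
  by apply/funext => t; rewrite /layer; ring.
have choquetZ Y : P.-integrable setT (EFin \o Y) ->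
    choquet P (fun s => c * phi s) Y = c * choquet P phi Y.
  by move=> iY; rewrite /choquet layerZ (RintegralZl _ measurableT (iphi _ iY)).
split => [Y iY|n Z iZ]; first by rewrite layerZ; exact: integrableZl_EFin (iphi _ iY).
rewrite choquetZ; last exact: integrable_sum_EFin.
under [leRHS]eq_bigr => i _ do rewrite choquetZ//.
by rewrite -mulr_sumr ler_wpM2l// sphi.
Qed.

Lemma choquet_linear a Y : P.-integrable setT (EFin \o Y) ->
  mu.-integrable setT (EFin \o layer P (fun s => a * s) Y 0) /\
  choquet P (fun s => a * s) Y = a * \int[P]_w Y w.
Proof.
move=> iY; have [il _] := expectation_layer iY.
have E : layer P (fun s => a * s) Y 0 = fun t => a * layer P idfun Y 0 t.
  by apply/funext => t; rewrite /layer /=; ring.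
split; first by rewrite E; exact: integrableZl_EFin il.
by rewrite /choquet E (RintegralZl _ measurableT il) (expectation_layer iY).2.
Qed.

Lemma subadditive_linear a : subadditive_distortion (fun s => a * s).
Proof.
split => [Y iY|n Z iZ]; first by have [] := choquet_linear a iY.
rewrite (choquet_linear a (integrable_sum_EFin iZ)).2.
rewrite Rintegral_sum// mulr_sumr; apply: ler_sum => i _.
by rewrite (choquet_linear a (iZ i)).2.
Qed.

(** [Num.min s a] lies below [s] and above [s - (1 - a)], so its layers are
    dominated by those of the identity, whose integral is the mean. *)
Lemma integrable_min Y a : 0 < a < 1 -> P.-integrable setT (EFin \o Y) ->
  mu.-integrable setT (EFin \o layer P (fun s => Num.min s a) Y 0).
Proof.
move=> /andP[a0 a1] iY; have [il _] := expectation_layer iY.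
have mY := mRV iY.
have il' : mu.-integrable setT (EFin \o (fun t => `|layer P idfun Y 0 t|)).
  exact: integrable_norm.
apply: le_integrable_EFin il'.
  apply: measurable_layer.
  exact: measurable_minr (measurable_tail P mY) (measurable_cst a).
move=> t; have /andP[s0 s1] := tail01 t mY.
rewrite /layer/= (min_r (ltW a1)); move: (tail P Y t) s0 s1 => s s0 s1.
case: (t < 0); rewrite ?mulr1 ?mulr0 ?subr0.
  rewrite !ler0_norm ?subr_le0 ?ge_min ?lexx ?orbT//.
  by rewrite lerN2; have [sa|sa] := leP s a; lra.
by rewrite !ger0_norm// ?le_min ?s0 ?(ltW a0)// ge_min lexx.
Qed.

Lemma integrable_maxr Y k : P.-integrable setT (EFin \o Y) ->
  P.-integrable setT (EFin \o (fun w => Num.max (Y w) k)).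
Proof.
move=> iY; have mY := mRV iY.
have iz : P.-integrable setT (EFin \o (fun w => `|Y w| + `|k|)).
  apply: integrableD_EFin; first exact: integrable_norm.
  exact: finite_measure_integrable_cst.
apply: le_integrable_EFin iz; first exact: measurable_maxr.
by move=> w; have [_|_] := leP (Y w) k; [rewrite lerDr|rewrite lerDl]; exact: normr_ge0.
Qed.

(** The formula of Rockafellar and Uryasev for the expected shortfall,
    [min_k (a k + E (Y - k)^+)], written with [max Y k = k + (Y - k)^+]. Both
    sides are Choquet integrals, and their layers at level [k] compare
    pointwise, with equality when [k] is a quantile of level [1 - a]. *)
Lemma choquet_min Y a : 0 < a < 1 -> P.-integrable setT (EFin \o Y) ->
  (forall k, choquet P (fun s => Num.min s a) Y <=
     \int[P]_w Num.max (Y w) k - (1 - a) * k) /\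
  (exists k, choquet P (fun s => Num.min s a) Y =
     \int[P]_w Num.max (Y w) k - (1 - a) * k).
Proof.
move=> a01 iY; have mY := mRV iY; have /andP[a0 a1] := a01.
have iM k := integrable_maxr k iY.
have imin := integrable_min a01 iY.
have imink k := layer_unshift k imin.
have iidk k := layer_unshift k (expectation_layer (iM k)).1.
have E k : choquet P (fun s => Num.min s a) Y =
    a * k + \int[mu]_t layer P (fun s => Num.min s a) Y k t.
  by rewrite (layer_shift (imink k)).2 (min_r (ltW a1)).
have E' k : \int[P]_w Num.max (Y w) k =
    k + \int[mu]_t layer P idfun (fun w => Num.max (Y w) k) k t.
  by rewrite (expectation_layer (iM k)).2 (layer_shift (iidk k)).2 mul1r.
have minE k t : layer P (fun s => Num.min s a) Y k t =
    Num.min (tail P Y t) a - a * (t < k)%R%:R.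
  by rewrite /layer (min_r (ltW a1)).
have maxE k t : layer P idfun (fun w => Num.max (Y w) k) k t =
    if t < k then 0 else tail P Y t.
  rewrite /layer/=; case: ltP => tk; first by rewrite tail_max_lt// mulr1 subrr.
  by rewrite tail_max_ge// mulr0 subr0.
split => [k|].
  rewrite (E k) E' (_ : k + _ - _ = a * k +
    \int[mu]_t layer P idfun (fun w => Num.max (Y w) k) k t); last by ring.
  rewrite lerD2l; apply: le_Rintegral; [exact: measurableT|exact: imink|exact: iidk|].
  move=> t _; rewrite minE maxE; have [_|_] := ltP t k.
    by rewrite mulr1 subr_le0 ge_min lexx orbT.
  by rewrite mulr0 subr0 ge_min lexx.
have [k [lk kl]] := tail_quantile P mY a01; exists k.
rewrite (E k) E' (_ : k + _ - _ = a * k +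
  \int[mu]_t layer P idfun (fun w => Num.max (Y w) k) k t); last by ring.
congr (_ + _); apply: eq_Rintegral => t _; rewrite minE maxE; have [tk|tk] := ltP t k.
  by rewrite (min_r (lk _ tk)) mulr1 subrr.
by rewrite (min_l (kl _ tk)) mulr0 subr0.
Qed.

(** If [k i] is optimal for [Z i], then [\sum_i k i] is a competitor for the sum
    of the [Z i]. *)
Lemma subadditive_min a : 0 < a < 1 -> subadditive_distortion (fun s => Num.min s a).
Proof.
move=> a01; split => [Y|n Z iZ]; first exact: integrable_min.
have /choice[k kE] := fun i => (choquet_min a01 (iZ i)).2.
have iS : P.-integrable setT (EFin \o (fun w => \sum_(i < n) Z i w)).
  exact: integrable_sum_EFin.
apply: (le_trans ((choquet_min a01 iS).1 (\sum_(i < n) k i))).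
under [leRHS]eq_bigr => i _ do rewrite kE.
rewrite sumrB -mulr_sumr lerD2r.
have iM i := integrable_maxr (k i) (iZ i).
rewrite -Rintegral_sum//; apply: le_Rintegral => //.
- exact: integrable_maxr.
- exact: integrable_sum_EFin.
- move=> w _; rewrite ge_max; apply/andP; split; apply: ler_sum => i _.
    by rewrite le_max lexx.
  by rewrite le_max lexx orbT.
Qed.

End subadditivity.

Section concave_choquet.
Context d (T : measurableType d) (R : realType) (P : probability T R).
Notation mu := (@lebesgue_measure R).

Let mRV Y : P.-integrable setT (EFin \o Y) -> measurable_fun setT Y.
Proof. by move=> iY; apply/measurable_EFinP; exact: measurable_int iY. Qed.

(** Summation by parts: up to a linear term, the interpolation is a combination
    of the functions [Num.min s (node j)] whose coefficients, the differences
    of consecutive slopes, are non-negative by concavity. *)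
Lemma subadditive_interp (h : R -> R) N : concave01 h -> h 0 = 0 ->
  subadditive_distortion P (interp h N N.+1).
Proof.
move=> ch h0.
(* The last term [slope N * Num.min s 1] is linear on the unit interval. *)
suff Q m : (m <= N)%N -> subadditive_distortion P
    (fun s => interp h N m.+1 s - slope h N m * Num.min s (node R N m.+1)).
  have := subadditive_distortionD (Q N (leqnn N)) (subadditive_linear P (slope h N N)).
  apply: eq_subadditive_distortion => s /andP[_ s1].
  by rewrite nodeN (min_l s1) subrK.
elim: m => [_|m IH mN].
  apply: (eq_subadditive_distortion _ (subadditive_linear P 0)) => s /andP[s0 _].
  rewrite /interp big_ord_recr big_ord0/= add0r node0 (min_r s0) subr0.
  by rewrite subrr mul0r.
have m01 : 0 < node R N m.+1 < 1.
  by rewrite divr_gt0//= ltr_pdivrMr// mul1r ltr_nat.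
have w0 : 0 <= slope h N m - slope h N m.+1.
  by rewrite subr_ge0 slope_nonincreasing.
have := subadditive_distortionD (IH (ltnW mN))
  (subadditive_distortionZ w0 (subadditive_min P m01)).
apply: eq_subadditive_distortion => s _.
by rewrite [interp h N m.+2 s]big_ord_recr/= -/(interp h N m.+1 s); ring.
Qed.

(** Subadditivity passes to the limit by Fatou's lemma because the
    interpolations stay above the chord [h 1 * s], whose Choquet integral is a
    multiple of the mean. *)
Theorem le_choquet_integrable (n : nat) (Z : 'I_n -> T -> R) (h : R -> R)
    (H : 'I_n -> R -> R) :
  concave01 h -> h 0 = 0 ->
  (forall i, P.-integrable setT (EFin \o Z i)) ->
  (forall i s, 0 <= s <= 1 -> h s <= H i s) -> (forall i, H i 1 = h 1) ->
  (forall i, mu.-integrable setT (EFin \o layer P (H i) (Z i) 0)) ->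
  let X := fun w => \sum_(i < n) Z i w in
  mu.-integrable setT (EFin \o layer P h X 0) /\
  choquet P h X <= \sum_(i < n) choquet P (H i) (Z i).
Proof.
move=> ch h0 iZ hH H1 iH X.
have iX : P.-integrable setT (EFin \o X) by exact: integrable_sum_EFin.
have mX := mRV iX.
have X01 t : 0 <= tail P X t <= 1 by rewrite tail_ge0 tail_le1.
pose C := \sum_(i < n) choquet P (H i) (Z i) - h 1 * \int[P]_w X w.
have [ilin clin] := choquet_linear (h 1) iX.
(* [u N] and its limit [v] are the non-negative gaps to the chord. *)
pose u N t := interp h N N.+1 (tail P X t) - h 1 * tail P X t.
pose v t := h (tail P X t) - h 1 * tail P X t.
have uE N : u N = fun t => layer P (interp h N N.+1) X 0 t - layer P (fun s => h 1 * s) X 0 t.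
  by apply/funext => t; rewrite /u /layer interp1// mulr1; ring.
have iI N := (subadditive_interp N ch h0).1.
have sI N := (subadditive_interp N ch h0).2.
have iu N : mu.-integrable setT (EFin \o u N).
  by rewrite uE; exact: integrableB_EFin (iI N _ iX) ilin.
have u0 N t : 0 <= u N t by rewrite subr_ge0 interp_ge_chord.
have uC N : \int[mu]_t u N t <= C.
  rewrite uE (RintegralB measurableT (iI N _ iX) ilin) lerB//.
    apply: (le_trans (sI N _ _ iZ)); apply: ler_sum => i _.
    apply: le_Rintegral => //; first exact: iI.
    move=> t _; rewrite /layer interp1// H1 lerB//.
    have Z01 : 0 <= tail P (Z i) t <= 1 by rewrite tail_ge0 tail_le1//; exact: mRV.
    by rewrite (le_trans (interp_le ch h0 _ Z01))// hH.
  by rewrite -clin.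
have cu t : (u N t) @[N --> \oo] --> v t.
  apply: cvgB; first exact: interp_cvg.
  exact: cvg_cst.
have mu_ N : measurable_fun setT (u N).
  by apply/measurable_EFinP; exact: measurable_int (iu N).
have mv : measurable_fun setT v by apply: measurable_fun_cvg mu_ _ => t _; exact: cu.
have v0 t : 0 <= v t.
  by rewrite (le_trans (u0 0 t))// lerB// interp_le.
have vC : (\int[mu]_t (v t)%:E <= C%:E)%E.
  have := @fatou _ _ _ mu setT measurableT (fun N t => (u N t)%:E).
  have einfE t : limn_einf (fun N => (u N t)%:E) = (v t)%:E.
    have cuE : (u N t)%:E @[N --> \oo] --> (v t)%:E by apply: cvg_EFin (cu t); exact: nearW.
    rewrite is_cvg_limn_einfE; last by apply/cvg_ex; exists (v t)%:E.
    exact: cvg_lim cuE.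
  under eq_integral => t _ do rewrite einfE.
  have mE N : measurable_fun setT (fun t => (u N t)%:E) by exact/measurable_EFinP.
  have uE0 N t : setT t -> (0 <= (u N t)%:E)%E by rewrite lee_fin.
  move=> /(_ mE uE0) /le_trans; apply.
  rewrite limn_einf_lim; apply: lime_le; first exact: is_cvg_einfs.
  apply: nearW => N; apply: (@le_trans _ _ (\int[mu]_t (u N t)%:E)%E).
    by apply: ereal_inf_lbound; exists N => /=.
  by rewrite -(fineK (integrable_fin_num measurableT (iu N))) lee_fin; exact: uC.
have iv : mu.-integrable setT (EFin \o v).
  apply/integrableP; split; first exact/measurable_EFinP.
  under eq_integral => t _ do rewrite /= ger0_norm//.
  exact: le_lt_trans vC (ltry _).
have layerE : layer P h X 0 = fun t => v t + layer P (fun s => h 1 * s) X 0 t.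
  by apply/funext => t; rewrite /v /layer mulr1; ring.
split; first by rewrite layerE; exact: integrableD_EFin iv ilin.
rewrite /choquet layerE (RintegralD measurableT iv ilin) -/(choquet P _ X) clin.
rewrite -lerBrDr -lee_fin fineK//.
exact: integrable_fin_num.
Qed.

End concave_choquet.

(** * Losses with a heavy lower tail *)

Section truncation.
Context d (T : measurableType d) (R : realType) (P : probability T R).
Notation mu := (@lebesgue_measure R).

Lemma measurable_concave_tail (h : R -> R) Y : concave01 h -> h 0 = 0 ->
  measurable_fun setT Y -> measurable_fun setT (h \o tail P Y).
Proof.
move=> ch h0 mY; have mt := measurable_tail P mY.
apply: (@measurable_fun_cvg _ _ _ _ (fun N => interp h N N.+1 \o tail P Y)).
  move=> N; apply: measurable_sum => j; apply: measurable_funM => //.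
  apply: measurable_funB; apply: measurable_minr => //.
by move=> t _; apply: interp_cvg => //; rewrite tail_ge0 tail_le1.
Qed.

Lemma layer_max_itv (h : R -> R) Y (m t : R) : 0 <= m ->
  layer P h (fun w => Num.max (Y w) (- m)) 0 t =
  if - m <= t then layer P h Y 0 t else 0.
Proof.
move=> m0; rewrite /layer; have [mt|mt] := leP (- m) t; first by rewrite tail_max_ge.
by rewrite tail_max_lt// (lt_le_trans mt) ?oppr_le0// mulr1 subrr.
Qed.

(** Truncating [Y] from below at [- m] erases its layers below [- m] and leaves
    the others, so the layers of [Y] dominate. *)
Lemma choquet_max_cvg (h : R -> R) Y : measurable_fun setT Y ->
  mu.-integrable setT (EFin \o layer P h Y 0) ->
  (forall m : nat, mu.-integrable setT
    (EFin \o layer P h (fun w => Num.max (Y w) (- m%:R)) 0)) /\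
  choquet P h (fun w => Num.max (Y w) (- m%:R)) @[m --> \oo] --> choquet P h Y.
Proof.
move=> mY iY.
have mL : measurable_fun setT (layer P h Y 0).
  by apply/measurable_EFinP; exact: measurable_int iY.
pose L (m : nat) t := if - m%:R <= t then layer P h Y 0 t else 0.
have LE (m : nat) : layer P h (fun w => Num.max (Y w) (- m%:R)) 0 = L m.
  by apply/funext => t; rewrite layer_max_itv.
have mLm m : measurable_fun setT (L m).
  by apply: measurable_fun_ifT => //; exact: measurable_fun_ler.
have Lle m t : `|L m t| <= `|layer P h Y 0 t|.
  by rewrite /L; case: ifP => // _; rewrite normr0.
have iL m : mu.-integrable setT (EFin \o L m).
  apply: (@le_integrable_EFin _ _ _ mu (L m) (fun t => `|layer P h Y 0 t|)) => //.
    exact: mLm.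
  exact: integrable_norm.
split => [m|]; first by rewrite LE.
have Lcvg t : (L m t)%:E @[m --> \oo] --> (layer P h Y 0 t)%:E.
  apply: cvg_near_cst; near=> m; rewrite /L ifT// lerNl.
  rewrite (le_trans (ler_norm _))// normrN.
  by near: m; exact: nbhs_infty_ger.
have [_ _] : [/\ mu.-integrable setT (fun t => (layer P h Y 0 t)%:E),
    [sequence \int[mu]_t `|(L m t)%:E - (layer P h Y 0 t)%:E|]_m @ \oo --> 0 &
    [sequence \int[mu]_t (L m t)%:E]_m @ \oo -->
      \int[mu]_t (layer P h Y 0 t)%:E]%E.
  apply: (@dominated_convergence _ _ _ mu setT measurableT
    (fun m t => (L m t)%:E) (fun t => (layer P h Y 0 t)%:E)
    (fun t => `|layer P h Y 0 t|%:E)).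
  - by move=> m; apply/measurable_EFinP; exact: mLm.
  - exact/measurable_EFinP.
  - by apply: aeW => t _; exact: Lcvg.
  - exact: integrable_norm.
  - by apply: aeW => t m _; rewrite lee_fin.
have -> : (\int[mu]_t (layer P h Y 0 t)%:E = (choquet P h Y)%:E)%E.
  by rewrite /choquet /Rintegral fineK//; exact: integrable_fin_num.
move=> /fine_cvgP[_].
by under [in X in _ -> X]eq_fun do rewrite /choquet LE.
Unshelve. all: by end_near. Qed.

(** The [Z i] need not be integrable, as their lower tails may be heavy.
    Truncating them from below at [- m] makes them integrable; a monotone [h]
    tolerates that this only increases the sum. *)
Theorem le_choquet_monotone (n : nat) (Z : 'I_n -> T -> R) (X : T -> R)
    (h : R -> R) (H : 'I_n -> R -> R) :
  concave01 h -> h 0 = 0 ->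
  (forall x y, 0 <= x -> x <= y -> y <= 1 -> h x <= h y) ->
  (forall i, measurable_fun setT (Z i)) -> measurable_fun setT X ->
  {ae P, forall w, X w = \sum_(i < n) Z i w} ->
  (forall i, \int[mu]_(t in `[0%R, +oo[) (tail P (Z i) t)%:E < +oo)%E ->
  (forall i s, 0 <= s <= 1 -> h s <= H i s) -> (forall i, H i 1 = h 1) ->
  (forall i, mu.-integrable setT (EFin \o layer P (H i) (Z i) 0)) ->
  mu.-integrable setT (EFin \o layer P h X 0) ->
  choquet P h X <= \sum_(i < n) choquet P (H i) (Z i).
Proof.
move=> ch h0 ndh mZ mX XZ finZ hH H1 iH iX.
pose Zm (m : nat) i w := Num.max (Z i w) (- m%:R).
have iZm m i : P.-integrable setT (EFin \o Zm m i).
  exact: integrable_max_tail.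
have cvgS : \sum_(i < n) choquet P (H i) (Zm m i) @[m --> \oo] -->
    \sum_(i < n) choquet P (H i) (Z i).
  apply: cvg_big => [|i _]; last exact: (choquet_max_cvg (mZ i) (iH i)).2.
  exact: add_continuous.
apply: (cvgr_to_ge cvgS).
apply: nearW => m.
have iHm i : mu.-integrable setT (EFin \o layer P (H i) (Zm m i) 0).
  exact: (choquet_max_cvg (mZ i) (iH i)).1.
have [im lem] := le_choquet_integrable ch h0 (iZm m) hH H1 iHm.
apply: le_trans lem; apply: le_Rintegral => // t _.
have mS : measurable_fun setT (fun w => \sum_(i < n) Zm m i w).
  by apply/measurable_EFinP; exact: measurable_int (integrable_sum_EFin (iZm m)).
rewrite /layer lerB// ndh ?tail_ge0 ?tail_le1// ae_le_tail//.
by apply: filterS XZ => w ->; apply: ler_sum => i _; rewrite le_max lexx.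
Qed.

End truncation.

(** * Expenses as Choquet integrals *)

Section distortions.
Context (R : realType) (g : R -> R).
Hypothesis hg : concave_distortion g.

Lemma distortion_ge0 s : 0 <= s <= 1 -> 0 <= g s.
Proof.
move=> s01; have := @distortion_range _ _ hg s; rewrite !in_itv/= s01.
by move=> /(_ isT) /andP[].
Qed.

Lemma distortion_le1 s : 0 <= s <= 1 -> g s <= 1.
Proof.
move=> s01; have := @distortion_range _ _ hg s; rewrite !in_itv/= s01.
by move=> /(_ isT) /andP[].
Qed.

Lemma distortion_concave01 : concave01 g.
Proof.
move=> x y t x01 y01 t01.
have := @distortion_concave _ _ hg (Itv01 (proj1 (andP t01)) (proj2 (andP t01))).
move=> /(_ x y); rewrite !inE/= !in_itv/= => /(_ x01 y01).
by rewrite convRE => ineq; rewrite -lerN2 opprD -!mulrN; exact: ineq.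
Qed.

(** A concave function lies above its chord. *)
Lemma le_distortion_id s : 0 <= s <= 1 -> s <= g s.
Proof.
move=> s01; have := distortion_concave01 (x := 1) (y := 0) _ _ s01.
rewrite (distortion0 hg) (distortion1 hg) !mulr0 !addr0 !mulr1.
by apply; rewrite lexx ler01.
Qed.

(** The expenses of an agent as the Choquet integral for a single distortion,
    normalised so that its value at 1 is the sign of [1 + b + c]. *)
Definition cost (b c s : R) : R := ((1 + b) * g s + c * s) / `|1 + b + c|.

Variables b c : R.
Hypotheses (b0 : 0 <= b) (a0 : 1 + b + c != 0).

Lemma cost0 : cost b c 0 = 0.
Proof. by rewrite /cost (distortion0 hg) !mulr0 addr0 mul0r. Qed.

Lemma cost1 : cost b c 1 = Num.sg (1 + b + c).
Proof.
by rewrite /cost (distortion1 hg) !mulr1 {1}(numEsg (1 + b + c)) mulfK ?normr_eq0.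
Qed.

Lemma concave_cost : concave01 (cost b c).
Proof.
move=> x y t x01 y01 t01; rewrite /cost.
rewrite !mulrA -mulrDl ler_wpM2r ?invr_ge0//.
have := distortion_concave01 x01 y01 t01.
move: (g _) (g x) (g y) => u v w uvw; have : 0 <= 1 + b by rewrite addr_ge0.
nra.
Qed.

Lemma cost_bounded s : 0 <= s <= 1 -> `|cost b c s| <= (1 + b + `|c|) / `|1 + b + c|.
Proof.
move=> s01; have /andP[s0 s1] := s01.
rewrite normrM normfV normr_id ler_wpM2r ?invr_ge0//.
rewrite (le_trans (ler_normD _ _))// lerD//; rewrite normrM.
  rewrite ger0_norm ?addr_ge0// ger0_norm ?distortion_ge0// ler_piMr ?addr_ge0//.
  exact: distortion_le1.
by rewrite (ger0_norm s0) ler_piMr.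
Qed.

End distortions.

Section total_cost.
Context d (T : measurableType d) (R : realType) (P : probability T R).
Notation mu := (@lebesgue_measure R).
Variables (g : R -> R) (b c : R).
Hypotheses (hg : concave_distortion g) (b0 : 0 <= b) (a0 : 1 + b + c != 0).

Lemma measurable_distortion_layer Y z : measurable_fun setT Y ->
  measurable_fun setT (layer P g Y z).
Proof.
move=> mY; apply: measurable_layer; apply: measurable_concave_tail => //.
  exact: distortion_concave01.
exact: distortion0.
Qed.

Lemma distortion_risk_layer (Y : {RV P >-> R}) : distortion_risk g Y =
  (\int[mu]_(t in `]-oo, 0%R[) (layer P g Y 0 t)%:E +
   \int[mu]_(t in `[0%R, +oo[) (layer P g Y 0 t)%:E)%E.
Proof.
rewrite /distortion_risk /layer survivalE (distortion1 hg); congr (_ + _)%E.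
  by apply: eq_integral => t; rewrite inE/= in_itv/= => ->; rewrite mulr1.
apply: eq_integral => t; rewrite inE/= in_itv/= andbT => t0.
by rewrite ltNge t0 mulr0 subr0.
Qed.

Lemma integrable_distortion_layer (Y : {RV P >-> R}) :
  distortion_risk g Y \is a fin_num -> mu.-integrable setT (EFin \o layer P g Y 0).
Proof.
rewrite distortion_risk_layer; apply: integrable_split0.
- exact: measurable_distortion_layer.
- move=> t t0; rewrite /layer t0 (distortion1 hg) mulr1 subr_le0.
  by apply: distortion_le1 => //; rewrite tail_ge0 tail_le1.
- move=> t t0; rewrite /layer ltNge t0/= mulr0 subr0.
  by apply: distortion_ge0 => //; rewrite tail_ge0 tail_le1.
Qed.

(** The layers of [g] dominate the tail, as [s <= g s]. *)
Lemma upper_tail_lty Y : measurable_fun setT Y ->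
  mu.-integrable setT (EFin \o layer P g Y 0) ->
  (\int[mu]_(t in `[0%R, +oo[) (tail P Y t)%:E < +oo)%E.
Proof.
move=> mY /integrableP[mL fin]; apply: le_lt_trans fin.
apply: (@le_trans _ _ (\int[mu]_(t in `[0%R, +oo[) `|(layer P g Y 0 t)%:E|)%E).
  apply: ge0_le_integral => //.
  - by move=> t _; rewrite lee_fin tail_ge0.
  - by apply/measurable_EFinP/measurable_funTS; exact: measurable_tail.
  - by apply: measurable_funTS; exact: measurableT_comp.
  - move=> t; rewrite /= in_itv/= andbT => t0; rewrite lee_fin.
    rewrite (le_trans _ (ler_norm _))// /layer ltNge t0 mulr0 subr0.
    by apply: le_distortion_id => //; rewrite tail_ge0 tail_le1.
apply: ge0_subset_integral => //; exact: measurableT_comp.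
Qed.

Lemma distortion_risk_choquet (Y : {RV P >-> R}) :
  mu.-integrable setT (EFin \o layer P g Y 0) ->
  distortion_risk g Y = (choquet P g Y)%:E.
Proof. by move=> iY; rewrite distortion_risk_layer integral_split0. Qed.

(** Neither term can compensate an infinite value of the other, because a finite
    sum of extended reals has finite terms. The mean is absent if [c = 0]. *)
Lemma total_cost_fin_num (Y : {RV P >-> R}) : total_cost g b c Y \is a fin_num <->
  mu.-integrable setT (EFin \o layer P g Y 0) /\
  (c != 0 -> P.-integrable setT (EFin \o Y)).
Proof.
have b1 : 0 < 1 + b by rewrite ltr_wpDr.
split=> [|[iL iY]].
  rewrite /total_cost fin_numD => /andP[fH fE]; split.
    apply: integrable_distortion_layer; move: fH.
    case: (distortion_risk g Y) => [//| |].
    - by rewrite gt0_muley ?lte_fin.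
    - by rewrite gt0_muleNy ?lte_fin.
  move=> c0; apply/integrableP; split; first exact/measurable_EFinP.
  have EY : ('E_P[Y] \is a fin_num)%E.
    rewrite -[X in X \is a fin_num]mul1e -(mulVf c0) EFinM -muleA.
    exact: fin_numM.
  rewrite (integral_fin_num_abs P measurableT (measurable_funPT Y)).
  by move: EY; rewrite expectation_def.
rewrite /total_cost (distortion_risk_choquet iL) fin_numD fin_numM//=.
have [->|c0] := eqVneq c 0; first by rewrite mul0e.
by rewrite fin_numM// expectation_def; apply: integrable_fin_num => //; exact: iY.
Qed.

Lemma total_cost_choquet (Y : {RV P >-> R}) :
  mu.-integrable setT (EFin \o layer P g Y 0) ->
  (c != 0 -> P.-integrable setT (EFin \o Y)) ->
  mu.-integrable setT (EFin \o layer P (cost g b c) Y 0) /\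
  total_cost g b c Y = (`|1 + b + c| * choquet P (cost g b c) Y)%:E.
Proof.
move=> iL iY.
set a := `|1 + b + c|; have a_neq0 : a != 0 by rewrite normr_eq0.
have layerE : layer P (cost g b c) Y 0 = fun t =>
    (1 + b) / a * layer P g Y 0 t + a^-1 * layer P (fun s => c * s) Y 0 t.
  by apply/funext => t; rewrite /layer /cost -/a; field.
have [ilin clin] : mu.-integrable setT (EFin \o layer P (fun s => c * s) Y 0) /\
    (choquet P (fun s => c * s) Y)%:E = (c%:E * 'E_P[Y])%E.
  have [->|c0] := eqVneq c 0.
    have -> : layer P (fun s => 0 * s) Y 0 = cst 0.
      by apply/funext => t; rewrite /layer !mul0r subr0.
    split; first exact: integrable0.
    rewrite mul0e /choquet; under eq_Rintegral do rewrite /layer !mul0r subr0.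
    by rewrite Rintegral_cst// mul0r.
  have [? ->] := choquet_linear c (iY c0); split => //.
  rewrite expectation_def EFinM; congr (_ * _)%E.
  by rewrite fineK//; apply: integrable_fin_num => //; exact: iY.
have i1 := integrableZl_EFin ((1 + b) / a) iL.
have i2 := integrableZl_EFin a^-1 ilin.
split; first by rewrite layerE; exact: integrableD_EFin.
rewrite /total_cost distortion_risk_choquet// -clin -EFinM -EFinD; congr (_%:E).
rewrite {3}/choquet layerE (RintegralD measurableT i1 i2).
rewrite (RintegralZl _ measurableT iL) (RintegralZl _ measurableT ilin).
by rewrite -/(choquet P g Y) -/(choquet P _ Y); field.
Qed.

End total_cost.

(** * Monotonicity and lower envelopes of concave functions *)

(** A point [y] above [x] is a convex combination of [x] and 1, where [h] is at
    least [h x]. *)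
Lemma concave01_nondecreasing (R : realType) (h : R -> R) : concave01 h ->
  (forall s, 0 <= s <= 1 -> h s <= h 1) ->
  forall x y, 0 <= x -> x <= y -> y <= 1 -> h x <= h y.
Proof.
move=> ch h1 x y x0 xy y1; have [x1|x1] := leP 1 x.
  by have -> : x = y by apply/eqP; rewrite eq_le xy (le_trans y1).
have t01 : 0 <= (1 - y) / (1 - x) <= 1.
  rewrite divr_ge0 ?subr_ge0 ?(ltW x1)//= ler_pdivrMr ?subr_gt0// mul1r.
  by rewrite lerB.
have x01 : 0 <= x <= 1 by rewrite x0 ltW.
have := ch x 1 _ x01 _ t01; rewrite ler01 lexx => /(_ isT).
have -> : (1 - y) / (1 - x) * x + (1 - (1 - y) / (1 - x)) * 1 = y.
  by field; rewrite gt_eqF// subr_gt0.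
apply: le_trans; have := h1 x x01; have /andP[t0 t1] := t01.
by move: ((1 - y) / (1 - x)) t0 t1 => t t0 t1 hx; nra.
Qed.

Section lower_envelope.
Context (R : realType) (n : nat) (H : 'I_n -> R -> R) (i0 : 'I_n).

Definition lower_envelope s : R := H [arg min_(i < i0) H i s]%O s.

Lemma lower_envelope_le i s : lower_envelope s <= H i s.
Proof. by rewrite /lower_envelope; case: arg_minP => // k _; exact. Qed.

Lemma lower_envelope_attained s : exists k, lower_envelope s = H k s.
Proof. by eexists. Qed.

Lemma lower_envelope_argmin i s :
  i \in argmin (fun k => H k s) -> H i s = lower_envelope s.
Proof.
move=> /forallP imin; apply/eqP; rewrite eq_le lower_envelope_le andbT.
exact: imin.
Qed.

Lemma concave_lower_envelope : (forall i, concave01 (H i)) -> concave01 lower_envelope.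
Proof.
move=> cH x y t x01 y01 t01; have [k ->] := lower_envelope_attained (t * x + (1 - t) * y).
apply: le_trans (cH k x y t x01 y01 t01); have /andP[t0 t1] := t01.
by rewrite lerD// ler_wpM2l ?lower_envelope_le// subr_ge0.
Qed.

Lemma lower_envelope_cst r s : (forall i, H i s = r) -> lower_envelope s = r.
Proof. by move=> Hr; rewrite /lower_envelope Hr. Qed.

End lower_envelope.

(** * Choquet integrals of comonotone shares *)

(** Shifting the level from 0 to [f 0] reduces these statements to the
    substitution formula. *)
Section choquet_comonotone.
Context d (T : measurableType d) (R : realType) (P : probability T R).
Notation mu := (@lebesgue_measure R).
Variables (f D phi : R -> R) (X : T -> R).
Hypotheses (ndf : {homo f : x y / x <= y}) (cf : continuous f).
Hypotheses (mD : measurable_fun setT D) (D0 : forall x, 0 <= D x).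
Hypothesis DE : forall a b, a <= b ->
  (\int[mu]_(x in `]a, b]) (D x)%:E)%E = (f b - f a)%:E.
Hypothesis phi0 : phi 0 = 0.
Hypothesis mphi : measurable_fun setT (phi \o tail P X).

Lemma integrable_comonotone :
  mu.-integrable setT (EFin \o (fun t => layer P phi X 0 t * D t)) <->
  mu.-integrable setT (EFin \o layer P phi (f \o X) 0).
Proof.
rewrite (integrable_layer_comp ndf cf mD D0 DE phi0 mphi).
by split => [/layer_shift[]//|]; exact: layer_unshift.
Qed.

Lemma choquet_comonotone :
  mu.-integrable setT (EFin \o (fun t => layer P phi X 0 t * D t)) ->
  choquet P phi (f \o X) = phi 1 * f 0 + \int[mu]_t (layer P phi X 0 t * D t).
Proof.
move=> iD.
have iL := (integrable_layer_comp ndf cf mD D0 DE phi0 mphi).1 iD.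
by rewrite (layer_shift iL).2 (Rintegral_layer_comp ndf cf mD D0 DE phi0 mphi iD).
Qed.

End choquet_comonotone.

(** * Pareto optimality *)

Section pareto.
Context d (T : measurableType d) (R : realType) (P : probability T R) (n : nat).
Notation mu := (@lebesgue_measure R).
Variables (g : 'I_n -> R -> R) (b c : 'I_n -> R) (X : {RV P >-> R}).
Hypotheses (hg : forall i, concave_distortion (g i)) (hb : forall i, 0 <= b i).
Hypothesis hbc : forall i j, 0 < (1 + b i + c i) * (1 + b j + c j).
Variable i0 : 'I_n.

Let V i := total_cost (P := P) (g i) (b i) (c i).
Let H i := cost (g i) (b i) (c i).
Let h := lower_envelope H i0.

Let a_neq0 i : 1 + b i + c i != 0.
Proof. by have := hbc i i; apply: contraTneq => ->; rewrite mul0r ltxx. Qed.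

(** All the [1 + b i + c i] have the same sign. *)
Lemma cost1_eq i j : H i 1 = H j 1.
Proof.
rewrite /H !cost1//; have := hbc i j.
move: (1 + b i + c i) (1 + b j + c j) => x y.
have [x0|x0|->] := ltgtP x 0; last by rewrite mul0r ltxx.
  by rewrite nmulr_rgt0// => y0; rewrite !ltr0_sg.
by rewrite pmulr_rgt0// => y0; rewrite !gtr0_sg.
Qed.

Let H0 i : H i 0 = 0.
Proof. exact: cost0. Qed.

Let mH i : measurable_fun setT (H i \o tail P X).
Proof. by apply: measurable_concave_tail => //; exact: concave_cost. Qed.

Let mg i : measurable_fun setT (g i \o tail P X).
Proof.
apply: measurable_concave_tail => //; first exact: distortion_concave01.
exact: distortion0.
Qed.

Let ch : concave01 h.
Proof. by apply: concave_lower_envelope => i; exact: concave_cost. Qed.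

Let h0 : h 0 = 0.
Proof. exact: lower_envelope_cst. Qed.

Let h1 i : h 1 = H i 1.
Proof. by apply: lower_envelope_cst => j; exact: cost1_eq. Qed.

(** If no [c i] is zero, finite expenses force integrable losses. If [c i = 0]
    for some [i], then [h] is below a multiple of [g i] with the same value at
    1. So [h] is largest at 1, hence non-decreasing by concavity, and losses
    with a heavy lower tail are allowed. *)
Lemma le_choquet_allocation (Z : 'I_n -> {RV P >-> R}) : allocation V X Z ->
  mu.-integrable setT (EFin \o layer P h X 0) ->
  choquet P h X <= \sum_(i < n) choquet P (H i) (Z i).
Proof.
move=> [XZ Vfin] iX.
have ZP i := (total_cost_fin_num (c i) (hg i) (hb i) (Z i)).1 (Vfin i).
have iH i : mu.-integrable setT (EFin \o layer P (H i) (Z i) 0).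
  by have [iL iZ] := ZP i; exact: (total_cost_choquet (hg i) (a_neq0 i) iL iZ).1.
have hH i s : 0 <= s <= 1 -> h s <= H i s by move=> _; exact: lower_envelope_le.
have H1 i : H i 1 = h 1 by rewrite (h1 i).
have [[i ci0]|cN0] := pselect (exists i, c i = 0).
  apply: (le_choquet_monotone ch h0) => //; last first.
    by move=> j; apply: (upper_tail_lty (hg j)) => //; exact: (ZP j).1.
  apply: concave01_nondecreasing => // s s01.
  rewrite (h1 i) (le_trans (hH i s s01))// /H /cost ci0 !mul0r !addr0.
  rewrite ler_wpM2r ?invr_ge0// ler_wpM2l ?addr_ge0//.
  by rewrite (distortion1 (hg i)) distortion_le1.
have iZ i : P.-integrable setT (EFin \o Z i).
  by apply: (ZP i).2; apply/eqP => ci0; apply: cN0; exists i.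
have [_] := le_choquet_integrable ch h0 iZ hH H1 iH.
have tailX : tail P X = tail P (fun w => \sum_(i < n) Z i w).
  apply: ae_eq_tail => //; exact: measurable_sum.
by rewrite /choquet /layer tailX.
Qed.

Variables (f : 'I_n -> R -> R) (Xstar : 'I_n -> {RV P >-> R}).
Hypothesis comon : comonotone_allocation V X f Xstar.

Let allocX : allocation V X Xstar. Proof. by case: comon. Qed.
Let XstarE i : (Xstar i : T -> R) = f i \o X.
Proof. by case: comon => _ XE _ _ _; apply/funext => w; exact: XE. Qed.
Let cf i : continuous (f i). Proof. by case: comon. Qed.
Let ndf i : {homo f i : x y / x <= y}. Proof. by case: comon. Qed.
Let sumf x : \sum_(i < n) f i x = x. Proof. by case: comon. Qed.

(** Two agents together are non-expansive, which leaves room for any transfer of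
    layers between them. *)
Let lipf2 i j x y : i != j -> x <= y ->
  (f i y - f i x) + (f j y - f j x) <= y - x.
Proof.
move=> ij xy; rewrite -[X in _ <= X - _]sumf -[X in _ <= _ - X]sumf -sumrB (bigD1 i)//=.
rewrite (bigD1 j)/=; last by rewrite eq_sym.
by rewrite [leRHS]addrA lerDl sumr_ge0// => k _; rewrite subr_ge0 ndf.
Qed.

Let lipf i x y : x <= y -> f i y - f i x <= y - x.
Proof. exact: comonotone_nonexpansive. Qed.

Variable D : 'I_n -> R -> R.
Hypotheses (mD : forall i, measurable_fun setT (D i)) (D0 : forall i x, 0 <= D i x).
Hypothesis DE : forall i x y, x <= y ->
  (\int[mu]_(t in `]x, y]) (D i t)%:E)%E = (f i y - f i x)%:E.
Hypothesis Df : {ae mu, forall x, forall i, derivable (f i) x 1 /\ derive1 (f i) x = D i x}.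

Let XP i : mu.-integrable setT (EFin \o layer P (g i) (Xstar i) 0) /\
  (c i != 0 -> P.-integrable setT (EFin \o Xstar i)).
Proof. by apply/total_cost_fin_num => //; exact: allocX.2. Qed.

Let iHD i : mu.-integrable setT (EFin \o (fun t => layer P (H i) X 0 t * D i t)).
Proof.
apply/(integrable_comonotone (@ndf i) (@cf i) (mD i) (D0 i) (@DE i) (H0 i) (mH i)).
rewrite -XstarE; have [iL iX] := XP i.
exact: (total_cost_choquet (hg i) (a_neq0 i) iL iX).1.
Qed.

Let choquet_Xstar i : choquet P (H i) (Xstar i) =
  H i 1 * f i 0 + \int[mu]_t (layer P (H i) X 0 t * D i t).
Proof.
rewrite XstarE (choquet_comonotone (@ndf i) (@cf i) (mD i) (D0 i) (@DE i))//; exact: mH.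
Qed.

Let V_choquet i (Y : {RV P >-> R}) : V i Y \is a fin_num ->
  V i Y = (`|1 + b i + c i| * choquet P (H i) Y)%:E.
Proof.
move=> /(total_cost_fin_num _ (hg i) (hb i))[iL iY].
exact: (total_cost_choquet (hg i) (a_neq0 i) iL iY).2.
Qed.

Let I t := argmin (fun k => H k (tail P X t)).

Let optimal := {ae mu, forall t : R,
  \sum_(i in I t) derive1 (f i) t = 1 /\
  (forall i, i \notin I t -> derive1 (f i) t = 0)}.

(** At almost every [t] the layer of [h] is the average, with weights
    [derive1 (f i) t], of the prices of the agents. The constants [f i 0] cancel
    since their sum is 0. *)
Lemma choquet_lower_envelope : optimal ->
  mu.-integrable setT (EFin \o layer P h X 0) /\
  choquet P h X = \sum_(i < n) choquet P (H i) (Xstar i).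
Proof.
move=> opt.
have ae_h : {ae mu, forall t, \sum_(i < n) layer P (H i) X 0 t * D i t = layer P h X 0 t}.
  have : {ae mu, forall t, (\sum_(i in I t) derive1 (f i) t = 1 /\
    (forall i, i \notin I t -> derive1 (f i) t = 0)) /\
    forall i, derivable (f i) t 1 /\ derive1 (f i) t = D i t}.
    by apply: filterI opt Df; exact: (ae_filter_ringOfSetsType mu).
  apply: filterS; first exact: (ae_filter_ringOfSetsType mu).
  move=> t [[sum1 out0] DfE].
  rewrite (bigID (fun i => i \in I t))/= [X in _ + X]big1 ?addr0; last first.
    by move=> i iI; rewrite -(DfE i).2 out0// mulr0.
  transitivity (\sum_(i in I t) layer P h X 0 t * derive1 (f i) t).
    apply: eq_bigr => i iI; rewrite (DfE i).2 /layer (h1 i).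
    by rewrite (lower_envelope_argmin i0 iI).
  by rewrite -mulr_sumr sum1 mulr1.
have mh : measurable_fun setT (layer P h X 0).
  by apply: measurable_layer; exact: measurable_concave_tail.
have [ih intE] := ae_eq_Rintegral (integrable_sum_EFin iHD) mh ae_h.
split => //; rewrite {1}/choquet -intE Rintegral_sum//.
under [RHS]eq_bigr do rewrite choquet_Xstar -(h1).
by rewrite big_split/= -mulr_sumr sumf mulr0 add0r.
Qed.

(** The sum of the Choquet integrals is minimal, so a decrease for one agent
    would be an increase for another. *)
Lemma optimal_pareto : optimal -> pareto_optimal V X Xstar.
Proof.
move=> /choquet_lower_envelope[ih chE]; split => // Z allocZ leZ.
have Zfin i : V i (Z i) \is a fin_num by case: allocZ.
have Xfin i : V i (Xstar i) \is a fin_num by case: allocX.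
have a_gt0 i : 0 < `|1 + b i + c i| by rewrite normr_gt0.
have leH i : choquet P (H i) (Z i) <= choquet P (H i) (Xstar i).
  have := leZ i; rewrite (V_choquet (Zfin i)) (V_choquet (Xfin i)).
  by rewrite lee_fin ler_pM2l.
have sumE : \sum_(i < n) choquet P (H i) (Z i) = \sum_(i < n) choquet P (H i) (Xstar i).
  apply/eqP; rewrite eq_le; apply/andP; split; first exact: ler_sum.
  by rewrite -chE; exact: le_choquet_allocation allocZ ih.
move=> i; rewrite (V_choquet (Zfin i)) (V_choquet (Xfin i)).
congr (_ * _)%:E; apply/eqP; rewrite eq_le leH/=.
have : 0 <= \sum_(k < n | k != i) (choquet P (H k) (Xstar k) - choquet P (H k) (Z k)).
  by apply: sumr_ge0 => k _; rewrite subr_ge0.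
move: sumE; rewrite sumrB (bigD1 i)//= [in RHS](bigD1 i)//=; lra.
Qed.

(** The layers in [A], a bounded set on which agent [i] has a positive share and
    agent [j] charges less than agent [i], are transferred from [i] to [j]. The
    transferred loss is [psi (X)], where [psi] has derivative [E], and [sg]
    records who gives and who receives. Agent [i] takes back the constant
    [kappa], chosen so that the expenses of this agent stay the same. *)
Section perturbation.
Variables (i j : 'I_n) (m : nat).
Hypothesis ij : i != j.

Let A : set R := [set t | (0 < D i t) && (H j (tail P X t) < H i (tail P X t))] `&`
  `]- m%:R, m%:R]%classic.

Let mA : measurable A.
Proof.
apply: measurableI => //.
have mlt : measurable_fun setT
    (fun t => (0 < D i t) && (H j (tail P X t) < H i (tail P X t))).
  apply: measurable_and; apply: measurable_fun_ltr => //.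
    exact: mH.
  exact: mH.
by rewrite -[X in measurable X]setTI; exact: (mlt measurableT [set true]).
Qed.

Let E t := \1_A t * D i t.

Let mE : measurable_fun setT E.
Proof. by apply: measurable_funM => //; exact: mD. Qed.

Let E_itv t : 0 <= E t <= D i t.
Proof.
by rewrite /E indicE; case: (t \in A); rewrite ?mul1r ?mul0r ?lexx ?D0.
Qed.

Let iDitv k x y : mu.-integrable `]x, y]%classic (EFin \o D k).
Proof.
have [xy|yx] := leP x y; last first.
  by rewrite set_itv_ge ?bnd_simp -?leNgt ?ltW//; exact: integrable_set0.
apply/integrableP; split; first by apply: measurable_funTS; apply/measurable_EFinP; exact: mD.
under eq_integral do rewrite /= ger0_norm ?D0//.
by rewrite (DE k xy) ltry.
Qed.

Let iE : mu.-integrable setT (EFin \o E).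
Proof.
apply: (@le_integrable_EFin _ _ _ mu E (D i \_ `]- m%:R, m%:R]%classic)) => //.
  move=> t; have /andP[E0 _] := E_itv t; rewrite ger0_norm// patchE /E indicE.
  case: ifPn => [_|]; first by case: (t \in A); rewrite ?mul1r ?mul0r ?D0.
  by rewrite notin_setE => tN; rewrite memNset ?mul0r// => -[].
by rewrite -restrict_EFin -integrable_mkcond//; exact: iDitv.
Qed.

Let psi x : R := \int[mu]_(t in `]-oo, x]) E t.

Let iEitv (J : interval R) : mu.-integrable [set` J] (EFin \o E).
Proof. exact: integrableS iE. Qed.

Let psiB x y : x <= y -> psi y - psi x = \int[mu]_(t in `]x, y]) E t.
Proof. by move=> xy; rewrite /psi Rintegral_itvB. Qed.

Let RDE k x y : x <= y -> \int[mu]_(t in `]x, y]) D k t = f k y - f k x.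
Proof. by move=> xy; rewrite /Rintegral DE. Qed.

Let psi_itv x y : x <= y -> 0 <= psi y - psi x <= f i y - f i x.
Proof.
move=> xy; rewrite psiB// Rintegral_ge0/=; last by move=> t _; case/andP: (E_itv t).
rewrite -RDE//; apply: le_Rintegral => //.
by move=> t _; case/andP: (E_itv t).
Qed.

Let psi_bounded x : 0 <= psi x <= \int[mu]_t E t.
Proof.
rewrite /psi Rintegral_ge0/=; last by move=> t _; case/andP: (E_itv t).
rewrite [leLHS]Rintegral_mkcond; apply: le_Rintegral => //.
  by rewrite -restrict_EFin -integrable_mkcond//; exact: iEitv.
move=> t _; rewrite patchE; case: ifP => // _; by case/andP: (E_itv t).
Qed.

Let sg k : R := (k == j)%:R - (k == i)%:R.

Let sg_i : sg i = -1. Proof. by rewrite /sg eqxx (negbTE ij) sub0r. Qed.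
Let sg_j : sg j = 1. Proof. by rewrite /sg eqxx eq_sym (negbTE ij) subr0. Qed.
Let sg_k k : k != i -> k != j -> sg k = 0.
Proof. by move=> /negbTE ki /negbTE kj; rewrite /sg ki kj subr0. Qed.

Let sum_sg : \sum_(k < n) sg k = 0.
Proof.
rewrite sumrB (bigD1 j)//= eqxx big1 ?addr0; last by move=> k /negbTE ->.
by rewrite (bigD1 i)//= eqxx big1 ?addr0 ?subrr// => k /negbTE ->.
Qed.

Let alpha k := \int[mu]_t (layer P (H k) X 0 t * E t).

(** The solution of [H i 1 * (psi 0 - kappa) + alpha i = 0], whose left side is
    the Choquet integral of [psi (X) - kappa] for [H i]. *)
Let kappa := psi 0 + alpha i / H i 1.

Let F k x := f k x + sg k * (psi x - kappa).

Let D' k t := D k t + sg k * E t.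

(** The new shares are still non-decreasing, since [E] is at most
    [D i], and non-expansive, by [lipf2]. *)
Let F_itv k x y : x <= y -> 0 <= F k y - F k x <= y - x.
Proof.
move=> xy; have /andP[p0 p1] := psi_itv xy; have := lipf2 ij xy.
have := lipf k xy; have /= := @ndf k _ _ xy; rewrite /F.
have [->|ki] := eqVneq k i; first by rewrite sg_i; lra.
have [->|kj] := eqVneq k j; first by rewrite sg_j; lra.
by rewrite sg_k//; lra.
Qed.

Let ndF k : {homo F k : x y / x <= y}.
Proof. by move=> x y xy; have /andP[] := F_itv k xy; rewrite subr_ge0. Qed.

Let cF k : continuous (F k).
Proof.
apply: nonexpansive_continuous; first exact: ndF.
by move=> x y xy; case/andP: (F_itv k xy).
Qed.

Let mD' k : measurable_fun setT (D' k).
Proof. by apply: measurable_funD; [exact: mD|exact: measurable_funM]. Qed.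

Let D'0 k t : 0 <= D' k t.
Proof.
have /andP[E0 E1] := E_itv t; have := D0 k t; rewrite /D'.
have [->|ki] := eqVneq k i; first by rewrite sg_i; lra.
have [->|kj] := eqVneq k j; first by rewrite sg_j; lra.
by rewrite sg_k//; lra.
Qed.

Let D'E k x y : x <= y ->
  (\int[mu]_(t in `]x, y]) (D' k t)%:E)%E = (F k y - F k x)%:E.
Proof.
move=> xy.
have mxy : measurable (`]x, y]%classic : set (measurableTypeR R)) by exact: measurable_itv.
have iZ : mu.-integrable `]x, y]%classic (EFin \o (fun t => sg k * E t)).
  exact: (integrableZl _ _ (iEitv _)).
have iDk : mu.-integrable `]x, y]%classic (EFin \o D' k).
  exact: (integrableD _ (iDitv k x y) iZ).
rewrite -[LHS]fineK; last exact: integrable_fin_num.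
rewrite -/(Rintegral mu `]x, y]%classic (D' k)) (RintegralD mxy (iDitv k x y) iZ).
rewrite (RintegralZl _ mxy (iEitv _)) RDE// -psiB//; congr (_%:E); rewrite /F; ring.
Qed.

Let layer_bounded (phi : R -> R) (K t : R) : (forall s, 0 <= s <= 1 -> `|phi s| <= K) ->
  `|layer P phi X 0 t| <= K + K.
Proof.
move=> phiK; have tP : 0 <= tail P X t <= 1 by rewrite tail_ge0 tail_le1.
rewrite /layer (le_trans (ler_normB _ _))// lerD ?phiK//.
have K1 : `|phi 1| <= K by rewrite phiK ?lexx ?ler01.
by case: (t < 0); rewrite ?mulr1 ?mulr0 ?normr0// (le_trans _ K1).
Qed.

Let iLE (phi : R -> R) (K : R) : measurable_fun setT (phi \o tail P X) ->
  (forall s, 0 <= s <= 1 -> `|phi s| <= K) ->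
  mu.-integrable setT (EFin \o (fun t => layer P phi X 0 t * E t)).
Proof.
move=> mphi phiK.
apply: (@le_integrable_EFin _ _ _ mu _ (fun t => (K + K) * E t)) => //.
- by apply: measurable_funM => //; exact: measurable_layer.
- move=> t; rewrite normrM; have /andP[E0 _] := E_itv t.
  by rewrite (ger0_norm E0) ler_wpM2r// layer_bounded.
- exact: integrableZl_EFin.
Qed.

Let iLD' k (phi : R -> R) (K : R) : phi 0 = 0 -> measurable_fun setT (phi \o tail P X) ->
  (forall s, 0 <= s <= 1 -> `|phi s| <= K) ->
  mu.-integrable setT (EFin \o layer P phi (Xstar k) 0) ->
  [/\ mu.-integrable setT (EFin \o (fun t => layer P phi X 0 t * D' k t)),
      mu.-integrable setT (EFin \o layer P phi (F k \o X) 0) &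
      choquet P phi (F k \o X) = choquet P phi (Xstar k) +
        sg k * (phi 1 * (psi 0 - kappa) + \int[mu]_t (layer P phi X 0 t * E t))].
Proof.
move=> phi0 mphi phiK iX; have iL := iLE mphi phiK.
have iLD : mu.-integrable setT (EFin \o (fun t => layer P phi X 0 t * D k t)).
  apply/(integrable_comonotone (@ndf k) (@cf k) (mD k) (D0 k) (@DE k) phi0 mphi).
  by rewrite -XstarE.
have LE : (fun t => layer P phi X 0 t * D' k t) =
    fun t => layer P phi X 0 t * D k t + sg k * (layer P phi X 0 t * E t).
  by apply/funext => t; rewrite /D'; ring.
have isL := integrableZl_EFin (sg k) iL.
have iLD'k : mu.-integrable setT (EFin \o (fun t => layer P phi X 0 t * D' k t)).
  by rewrite LE; exact: integrableD_EFin.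
split => //.
  exact/(integrable_comonotone (@ndF k) (@cF k) (mD' k) (D'0 k) (@D'E k) phi0 mphi).
rewrite (choquet_comonotone (@ndF k) (@cF k) (mD' k) (D'0 k) (@D'E k) phi0 mphi)//.
rewrite XstarE (choquet_comonotone (@ndf k) (@cf k) (mD k) (D0 k) (@DE k) phi0 mphi)//.
rewrite LE (RintegralD measurableT iLD isL) (RintegralZl _ measurableT iL).
by rewrite /F; ring.
Qed.

Let mF k : measurable_fun setT (F k \o X).
Proof.
apply: measurableT_comp (measurable_funPT X).
exact: nondecreasing_measurable (@ndF k).
Qed.

Let Z k : {RV P >-> R} := mfun_Sub (mem_set (mF k)).

Let Hbounded k s : 0 <= s <= 1 -> `|H k s| <= (1 + b k + `|c k|) / `|1 + b k + c k|.
Proof. exact: cost_bounded. Qed.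

(** The expenses stay finite because [psi] is bounded: the window of [A] is
    bounded, and so are the layers of all the distortions. *)
Let V_Z k : V k (Z k) \is a fin_num /\
  choquet P (H k) (Z k) = choquet P (H k) (Xstar k) + sg k * (alpha k - alpha i).
Proof.
have [iL iX] := XP k.
have g1 s : 0 <= s <= 1 -> `|g k s| <= 1.
  by move=> s01; rewrite ger0_norm ?distortion_ge0 ?distortion_le1.
have [_ iZ _] := @iLD' k _ _ (distortion0 (hg k)) (mg k) g1 iL.
split.
  apply/(total_cost_fin_num _ (hg k) (hb k)); split => // ck0.
  have mpsi : measurable_fun setT (fun w => psi (X w) - kappa).
    apply: measurable_funB => //.
    apply: measurableT_comp (measurable_funPT X); apply: nondecreasing_measurable => //.
    by move=> x y xy; rewrite -subr_ge0; case/andP: (psi_itv xy).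
  have iB : P.-integrable setT (EFin \o (fun w => psi (X w) - kappa)).
    apply: (@le_integrable_EFin _ _ _ P _ (fun=> \int[mu]_t E t + `|kappa|)) => //.
      move=> w; rewrite (le_trans (ler_normB _ _))// lerD2r.
      by have /andP[p0 p1] := psi_bounded (X w); rewrite ger0_norm.
    exact: finite_measure_integrable_cst.
  rewrite (_ : (Z k : T -> R) = fun w => Xstar k w + sg k * (psi (X w) - kappa)).
    by apply: integrableD_EFin; [exact: iX|exact: integrableZl_EFin].
  by apply/funext => w; rewrite XstarE.
have [iHX _] := total_cost_choquet (hg k) (a_neq0 k) iL iX.
have [_ _ ->] := @iLD' k _ _ (H0 k) (mH k) (@Hbounded k) iHX.
have H1_neq0 : H i 1 != 0 by rewrite /H cost1// sgr_eq0.
rewrite -/(alpha k) /kappa (cost1_eq k i : H k 1 = H i 1).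
by congr (_ + _ * _); field.
Qed.

Let layer_diff t : t \in A -> 0 < layer P (H i) X 0 t - layer P (H j) X 0 t.
Proof.
rewrite inE => -[/= /andP[_ lt_ji] _].
by rewrite /layer (cost1_eq i j : H i 1 = H j 1); lra.
Qed.

(** The transfer leaves all the other expenses unchanged and lowers those of
    agent [j] by a multiple of the integral over [A] of
    [(layer_i - layer_j) * D i], a positive function on [A]. *)
Lemma pareto_negligible : pareto_optimal V X Xstar -> mu.-negligible A.
Proof.
move=> [_ opt].
have Vfin k := (V_Z k).1.
have Xfin k : V k (Xstar k) \is a fin_num by case: allocX.
have iLH k : mu.-integrable setT (EFin \o (fun t => layer P (H k) X 0 t * E t)).
  exact: iLE (mH k) (@Hbounded k).
have G0 t : 0 <= (layer P (H i) X 0 t - layer P (H j) X 0 t) * E t.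
  have /andP[E0 _] := E_itv t; rewrite /E indicE.
  have [tA|tA] := boolP (t \in A); last by rewrite mul0r mulr0.
  by rewrite mul1r mulr_ge0 ?D0// ltW// layer_diff.
have GE : (fun t => (layer P (H i) X 0 t - layer P (H j) X 0 t) * E t) =
    fun t => layer P (H i) X 0 t * E t - layer P (H j) X 0 t * E t.
  by apply/funext => t; ring.
have iG : mu.-integrable setT
    (EFin \o (fun t => (layer P (H i) X 0 t - layer P (H j) X 0 t) * E t)).
  by rewrite GE; exact: integrableB_EFin.
have intG : \int[mu]_t ((layer P (H i) X 0 t - layer P (H j) X 0 t) * E t) =
    alpha i - alpha j.
  by rewrite GE (RintegralB measurableT (iLH i) (iLH j)).
have alpha_ji : alpha j <= alpha i by rewrite -subr_ge0 -intG Rintegral_ge0.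
have allocZ : allocation V X Z.
  split => //; apply: aeW => w; rewrite -[LHS]sumf.
  by rewrite -[RHS]/(\sum_(k < n) F k (X w)) big_split/= -mulr_suml sum_sg mul0r addr0.
have leZ k : (V k (Z k) <= V k (Xstar k))%E.
  rewrite (V_choquet (Vfin k)) (V_choquet (Xfin k)) lee_fin ler_wpM2l// (V_Z k).2.
  have [->|ki] := eqVneq k i; first by rewrite subrr mulr0 addr0.
  have [->|kj] := eqVneq k j; first by rewrite sg_j mul1r gerDl subr_le0.
  by rewrite sg_k// mul0r addr0.
have := opt Z allocZ leZ j.
rewrite (V_choquet (Vfin j)) (V_choquet (Xfin j)) (V_Z j).2 sg_j mul1r => -[].
move=> /mulfI; rewrite normr_eq0 => /(_ (a_neq0 j)) alphaE.
have intG0 : \int[mu]_t ((layer P (H i) X 0 t - layer P (H j) X 0 t) * E t) = 0.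
  by rewrite intG; lra.
have mG : measurable_fun setT
    (EFin \o (fun t => (layer P (H i) X 0 t - layer P (H j) X 0 t) * E t)).
  exact: measurable_int iG.
have absG0 : (\int[mu]_t `|((layer P (H i) X 0 t - layer P (H j) X 0 t) * E t)%:E| = 0)%E.
  under eq_integral => t _ do rewrite /= ger0_norm//.
  rewrite -[LHS]fineK; last exact: integrable_fin_num.
  by rewrite -[fine _]/(\int[mu]_t _) intG0.
have aeG0 := (ae_eq_integral_abs mu measurableT mG).1 absG0.
apply: negligibleS aeG0 => t tA /= /(_ Logic.I)[].
move=> /eqP; rewrite mulf_eq0; apply/negP; rewrite negb_or.
have tA' : t \in A by rewrite inE.
rewrite gt_eqF ?layer_diff//= /E indicE tA' mul1r gt_eqF//.
by case: tA => /= /andP[].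
Qed.

End perturbation.

(** For almost every [t] no agent outside [I t] carries the layer [t]. The other
    derivatives then sum to 1 because the sum of the [f i] is the identity. *)
Lemma pareto_optimal_derive : pareto_optimal V X Xstar -> optimal.
Proof.
move=> opt.
have aeA : {ae mu, forall t, forall (ij : 'I_n * 'I_n) (m : nat), ij.1 != ij.2 ->
    ~ ([set t | (0 < D ij.1 t) && (H ij.2 (tail P X t) < H ij.1 (tail P X t))] `&`
       `]- m%:R, m%:R]%classic) t}.
  apply: filter_forall => -[i j]; apply: ae_foralln => m /=.
  have [->|ij] := eqVneq i j; first by apply: aeW => t /eqP.
  apply: negligibleS (pareto_negligible m ij opt) => t /= tN.
  by apply: contrapT => tA; apply: tN.
have : {ae mu, forall t, (forall (ij : 'I_n * 'I_n) (m : nat), ij.1 != ij.2 ->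
    ~ ([set t | (0 < D ij.1 t) && (H ij.2 (tail P X t) < H ij.1 (tail P X t))] `&`
       `]- m%:R, m%:R]%classic) t) /\
    forall i, derivable (f i) t 1 /\ derive1 (f i) t = D i t}.
  by apply: filterI aeA Df; exact: (ae_filter_ringOfSetsType mu).
apply: filterS; first exact: (ae_filter_ringOfSetsType mu).
move=> t [tA DfE].
have out0 i : i \notin I t -> derive1 (f i) t = 0.
  rewrite negb_forall => /existsP[j]; rewrite -ltNge => Hji.
  rewrite (DfE i).2; apply/eqP; rewrite eq_le D0 andbT leNgt; apply/negP => Di0.
  have ij : i != j by apply: contraTneq Hji => ->; rewrite ltxx.
  have : `|t| < (Num.bound `|t|)%:R by exact: archi_boundP.
  rewrite ltr_norml => /andP[t1 t2].
  apply: (tA (i, j) (Num.bound `|t|) ij); split => /=; first by rewrite Di0 Hji.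
  by rewrite in_itv/= t1 ltW.
split => //.
have sum1 : \sum_(i < n) derive1 (f i) t = 1.
  under eq_bigr do rewrite derive1E.
  rewrite -derive_sum; last by move=> i; exact: (DfE i).1.
  rewrite (_ : \sum_(i < n) f i = id) ?derive_id//.
  by apply/funext => x; rewrite fct_sumE sumf.
rewrite -[RHS]sum1 [RHS](bigID (fun i => i \in I t))/= [X in _ + X]big1 ?addr0//.
Qed.

End pareto.

Theorem theorem3 (d : measure_display) (T : measurableType d) (R : realType)
    (P : probability T R) (n : nat) (hn : (2 <= n)%N)
    (X0 : 'I_n -> {RV P >-> R}) (g : 'I_n -> R -> R) (b c : 'I_n -> R)
    (X : {RV P >-> R}) (hX : forall w, X w = \sum_(i < n) X0 i w)
    (hg : forall i, concave_distortion (g i))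
    (hb : forall i, 0 <= b i)
    (hX0 : forall i, distortion_risk (g i) (X0 i) \is a fin_num)
    (hbc : forall i j, 0 < (1 + b i + c i) * (1 + b j + c j))
    (f : 'I_n -> R -> R) (Xstar : 'I_n -> {RV P >-> R}) :
  let V := fun i => total_cost (g i) (b i) (c i) in
  let I := fun t => argmin (fun k =>
    ((1 + b k) * g k (survival X t) + c k * survival X t)
      / `|1 + b k + c k|) in
  comonotone_allocation V X f Xstar ->
  (pareto_optimal V X Xstar <->
   {ae lebesgue_measure, forall t : R,
      \sum_(i in I t) derive1 (f i) t = 1 /\
      (forall i, i \notin I t -> derive1 (f i) t = 0)}).
Proof.
move=> V I comon; rewrite /I survivalE.
have i0 : 'I_n := Ordinal (ltnW hn).
have [_ _ _ ndf sumf] := comon.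
have /choice[D DP] := fun i =>
  nonexpansive_density (ndf i) (comonotone_nonexpansive ndf sumf i).
have mD i : measurable_fun setT (D i) by have [] := DP i.
have D0 i x : 0 <= D i x by have [] := DP i.
have DE i x y (xy : x <= y) := let: And4 _ _ h _ := DP i in h x y xy.
have Df : {ae lebesgue_measure, forall x : R, forall i : 'I_n,
    derivable (f i) x 1 /\ derive1 (f i) x = D i x}.
  by apply: filter_forall => i; have [] := DP i.
split.
  exact: (pareto_optimal_derive hg hb hbc comon mD D0 DE Df).
exact: (optimal_pareto hg hb hbc i0 comon mD D0 DE Df).
Qed.
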